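(* The full subcategory $\mathrm{pres}(\mathcal{J})$ of $\mathcal{J}$-presentable functors is an abelian subcategory of $\mathrm{Vect}_{\mathbb{F}}^{\mathbb{M}^{\circ}}$ (i.e. it is closed under kernels and cokernels computed in $\mathrm{Vect}_{\mathbb{F}}^{\mathbb{M}^{\circ}}$). Moreover $\mathrm{pres}(\mathcal{J})$ is a Frobenius abelian category: it has enough projectives and enough injectives, the projective and injective objects coincide, and an object of $\mathrm{pres}(\mathcal{J})$ is projective(-injective) if and only if it lies in $\mathcal{J}$.
   Context: Fix a field $\mathbb{F}$; $\mathrm{Vect}_{\mathbb{F}}$ denotes $\mathbb{F}$-vector spaces. Equip $\mathbb{R}^2$ with the partial order $(x,y)\preceq(x',y')$ iff $x'\le x$ and $y\le y'$. Fix reals $a<b$, let $l_0=\{(x,y):x+y=a\}$, $l_1=\{(x,y):x+y=b\}$, and $\mathbb{M}=\{(x,y): a\le x+y\le b\}$, with $\partial\mathbb{M}=l_0\cup l_1$ and $\operatorname{int}\mathbb{M}=\mathbb{M}\setminus\partial\mathbb{M}$. Let $T:\mathbb{M}\to\mathbb{M}$, $T(x,y)=(a-y,\,b-x)$ (an order automorphism). For $u\in\mathbb{M}$ write ${\uparrow}u=\{v\in\mathbb{M}:u\preceq v\}$, ${\downarrow}u=\{v\in\mathbb{M}:v\preceq u\}$; $\operatorname{int}$ of a subset means its interior in $\mathbb{M}$ (Euclidean topology). A functor $G:\mathbb{M}^{\circ}\to\mathrm{Vect}_{\mathbb{F}}$ assigns to $u\preceq v$ a linear map $G(v)\to G(u)$.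 A functor $G$ vanishing on $\partial\mathbb{M}$ is \emph{cohomological} if for every axis-aligned rectangle in $\mathbb{M}$ having one corner on $l_1$ and remaining corners $u\preceq v\preceq w$, the sequence $\cdots\to G(T(u))\to G(w)\to G(v)\to G(u)\to G(T^{-1}(w))\to G(T^{-1}(v))\to G(T^{-1}(u))\to\cdots$ obtained by applying $G$ to the chain $\cdots\preceq T^{-1}(u)\preceq T^{-1}(v)\preceq T^{-1}(w)\preceq u\preceq v\preceq w\preceq T(u)\preceq\cdots$ is exact. $G$ is \emph{sequentially continuous} if for every $\preceq$-increasing sequence $(u_k)$ in $\mathbb{M}$ converging (Euclidean) to $u$, the natural map $G(u)\to\varprojlim_k G(u_k)$ is an isomorphism. $G$ is pfd if all $G(u)$ are finite-dimensional, and has bounded above support if there is $w\in\mathbb{M}$ with $G(u)=0$ for all $u\notin{\downarrow}w$. $\mathcal{J}$ is the full subcategory of $\mathrm{Vect}_{\mathbb{F}}^{\mathbb{M}^{\circ}}$ of pfd, cohomological (in particular vanishing on $\partial\mathbb{M}$), sequentially continuous functors with bounded above support. A functor $F$ is \emph{$\mathcal{J}$-presentable} if there is an exact sequence $H\to G\to F\to 0$ with $H,G\in\mathcal{J}$; $\mathrm{pres}(\mathcal{J})$ is the full subcategory of such functors. *)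

(* Defs.v *)
From HB Require Import structures.
From mathcomp Require Import all_boot all_order all_algebra.
From mathcomp Require Import all_classical all_reals all_analysis.
From mathcomp Require Import lra.
Set Implicit Arguments. Unset Strict Implicit. Unset Printing Implicit Defensive.
Import Order.TTheory GRing.Theory Num.Theory.
Import numFieldNormedType.Exports.
Local Open Scope ring_scope.
Local Open Scope classical_set_scope.

Section Strip.
Variables (R : realType) (a b : R).

Definition inM (p : R * R) : bool := (a <= p.1 + p.2) && (p.1 + p.2 <= b).
Definition pt := {p : R * R | inM p}.

Definition ple (u v : pt) : bool :=
  ((sval v).1 <= (sval u).1) && ((sval u).2 <= (sval v).2).

Definition on_bd (u : pt) : Prop :=
  (sval u).1 + (sval u).2 = a \/ (sval u).1 + (sval u).2 = b.

Lemma T_inM (p : R * R) : inM p -> inM (a - p.2, b - p.1).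
Proof. rewrite /inM /= => /andP[h1 h2]; apply/andP; split; lra. Qed.

Lemma Tinv_inM (p : R * R) : inM p -> inM (b - p.2, a - p.1).
Proof. rewrite /inM /= => /andP[h1 h2]; apply/andP; split; lra. Qed.

Definition Tmap (u : pt) : pt :=
  exist _ (a - (sval u).2, b - (sval u).1) (T_inM (proj2_sig u)).
Definition Tinv (u : pt) : pt :=
  exist _ (b - (sval u).2, a - (sval u).1) (Tinv_inM (proj2_sig u)).

Definition Tz (k : int) : pt -> pt :=
  match k with Posz n => iter n Tmap | Negz n => iter n.+1 Tinv end.

End Strip.

Section Modules.
Variables (R : realType) (a b : R) (F : fieldType).

Record pmod := PMod {
  pm_obj : pt a b -> lmodType F;
  pm_map : forall u v : pt a b, ple u v -> {linear pm_obj v -> pm_obj u};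
  pm_id : forall u (h : ple u u) (x : pm_obj u), pm_map h x = x;
  pm_comp : forall u v w (huv : ple u v) (hvw : ple v w) (huw : ple u w)
      (x : pm_obj w), pm_map huv (pm_map hvw x) = pm_map huw x }.

Record pmor (G H : pmod) := PMor {
  pmor_fun : forall u, {linear pm_obj G u -> pm_obj H u};
  pmor_nat : forall u v (h : ple u v) (x : pm_obj G v),
      pmor_fun u (pm_map G h x) = pm_map H h (pmor_fun v x) }.

(** G(u <= v) as a plain function, only ever used when u <= v holds
    (it is 0 otherwise). *)
Definition rmap (G : pmod) (u v : pt a b) : pm_obj G v -> pm_obj G u :=
  fun x => (if ple u v as c return ple u v = c -> pm_obj G u
            then fun h => pm_map G h x else fun _ => 0) (erefl _).

Definition exact_at (A B C : lmodType F) (f : A -> B) (g : B -> C) : Prop :=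
  forall y, g y = 0 <-> exists x, f x = y.

Definition fin_dim (V : lmodType F) : Prop :=
  exists n (e : 'I_n -> V), forall x : V,
    exists c : 'I_n -> F, x = \sum_(i < n) c i *: e i.

Definition pfd (G : pmod) : Prop := forall u, fin_dim (pm_obj G u).

Definition vanishes_on_bd (G : pmod) : Prop :=
  forall u, on_bd u -> forall x : pm_obj G u, x = 0.

(** Rectangle [x0,x1] x [y0,y1] in M with corner (x1,y1) on l1 and remaining
    corners u = (x1,y0) <= v = (x0,y0) <= w = (x0,y1); the sequence
    ... -> G(T^{k+1} u) -> G(T^k w) -> G(T^k v) -> G(T^k u) -> G(T^{k-1} w) -> ...
    is exact at every term. *)
Definition cohomological (G : pmod) : Prop :=
  vanishes_on_bd G /\
  forall u v w : pt a b,
    (sval u).2 = (sval v).2 -> (sval v).1 = (sval w).1 ->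
    (sval v).1 <= (sval u).1 -> (sval v).2 <= (sval w).2 ->
    (sval u).1 + (sval w).2 = b ->
    forall k : int,
      exact_at (@rmap G (Tz k v) (Tz k w)) (@rmap G (Tz k u) (Tz k v)) /\
      exact_at (@rmap G (Tz k u) (Tz k v)) (@rmap G (Tz (k - 1) w) (Tz k u)) /\
      exact_at (@rmap G (Tz k w) (Tz (k + 1) u)) (@rmap G (Tz k v) (Tz k w)).

(** For every increasing sequence u_k -> u, G(u) -> lim G(u_k) is bijective. *)
Definition seq_continuous (G : pmod) : Prop :=
  forall (us : nat -> pt a b) (u : pt a b),
    (forall k, ple (us k) (us k.+1)) ->
    ((fun k => sval (us k)) @ \oo --> sval u) ->
    (forall x : pm_obj G u, (forall k, @rmap G (us k) u x = 0) -> x = 0) /\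
    (forall xs : forall k, pm_obj G (us k),
        (forall k, @rmap G (us k) (us k.+1) (xs k.+1) = xs k) ->
        exists x : pm_obj G u, forall k, @rmap G (us k) u x = xs k).

Definition bdd_above_support (G : pmod) : Prop :=
  exists w : pt a b, forall u, ~~ ple u w -> forall x : pm_obj G u, x = 0.

Definition inJ (G : pmod) : Prop :=
  pfd G /\ cohomological G /\ seq_continuous G /\ bdd_above_support G.

Definition presJ (X : pmod) : Prop :=
  exists (H G : pmod) (f : pmor H G) (g : pmor G X),
    inJ H /\ inJ G /\
    forall u, (forall z, exists y, pmor_fun g u y = z) /\
              exact_at (pmor_fun f u) (pmor_fun g u).

Definition is_kernel (A B K : pmod) (f : pmor A B) (k : pmor K A) : Prop :=
  forall u, injective (pmor_fun k u) /\ exact_at (pmor_fun k u) (pmor_fun f u).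

Definition is_cokernel (A B C : pmod) (f : pmor A B) (c : pmor B C) : Prop :=
  forall u, (forall z, exists y, pmor_fun c u y = z) /\
            exact_at (pmor_fun f u) (pmor_fun c u).

Definition epi_presJ (X Y : pmod) (e : pmor X Y) : Prop :=
  forall (Z : pmod) (g1 g2 : pmor Y Z), presJ Z ->
    (forall u x, pmor_fun g1 u (pmor_fun e u x) = pmor_fun g2 u (pmor_fun e u x)) ->
    forall u y, pmor_fun g1 u y = pmor_fun g2 u y.

Definition mono_presJ (X Y : pmod) (m : pmor X Y) : Prop :=
  forall (Z : pmod) (g1 g2 : pmor Z X), presJ Z ->
    (forall u z, pmor_fun m u (pmor_fun g1 u z) = pmor_fun m u (pmor_fun g2 u z)) ->
    forall u z, pmor_fun g1 u z = pmor_fun g2 u z.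

Definition projective_presJ (P : pmod) : Prop :=
  presJ P /\
  forall (X Y : pmod) (e : pmor X Y) (f : pmor P Y),
    presJ X -> presJ Y -> epi_presJ e ->
    exists g : pmor P X, forall u x, pmor_fun e u (pmor_fun g u x) = pmor_fun f u x.

Definition injective_presJ (I : pmod) : Prop :=
  presJ I /\
  forall (X Y : pmod) (m : pmor X Y) (f : pmor X I),
    presJ X -> presJ Y -> mono_presJ m ->
    exists g : pmor Y I, forall u x, pmor_fun g u (pmor_fun m u x) = pmor_fun f u x.

End Modules.

(* Main.v *)
Require Import Defs.
From HB Require Import structures.
From mathcomp Require Import all_boot all_order all_algebra.
From mathcomp Require Import all_classical all_reals all_analysis.
From mathcomp Require Import lra.
Set Implicit Arguments. Unset Strict Implicit. Unset Printing Implicit Defensive.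
Import Order.TTheory GRing.Theory Num.Theory.
Import numFieldNormedType.Exports.
Local Open Scope ring_scope.

(** Write points of the strip as p = (x, y). For a functor G vanishing on the boundary,
    being cohomological means that the kernel of a horizontal structure map is the image
    of a vertical one and vice versa. So G(p) carries two filtrations, by the images of the
    points to the left of p and of those above p; sequential continuity makes their jumps
    attained, and splitting them shows that G in J is a locally finite direct sum of blocks,
    i.e. of representable functors modulo the boundary. By the Yoneda lemma blocks are
    projective among functors vanishing on the boundary. They are injective because a map
    from X to a block is a functional on the colimit of the X(p_k), for p_k decreasing to
    the open lower corner of the block.

    A map f : H -> G in J lifts to a map V -> W of spaces with two filtrations spanned by the
    generators. Every space U with two filtrations A, C yields the cohomological functor
      p |-> (A_x cap C_y) / (A_(a-y) cap C_y + A_x cap C_(b-x)),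
    and applying this to the cocone U of V -> W gives a functor L with an exact sequence
      H(Tp) -> G(Tp) -> L(p) -> H(p) -> G(p).
    By the five lemma L is in J, so J has weak kernels and, applying T^-1, weak cokernels;
    the rest is formal. *)

(** * Linear algebra *)

Section LinearAlgebra.
Variable F : fieldType.
Implicit Types V W : lmodType F.

(** Pointwise kernels and cokernels of maps in J need not be cohomological: the kernel of a map
    between two blocks can be a smaller rectangle. Hence J is only asked for objects that map onto
    kernels, or that receive cokernels injectively, and presentations need no more. The kernel of V
    -> W with the induced filtrations would not do, because an element of W may be hit by V not at
    all or only at a wrong level. The cure is to add generators that the associated functor does not
    see: blocks with top on the boundary vanish, so a generator of W at (x_j, y_j) may be doubled by
    one at (x_j, a - x_j) on l_0 and one at (b - y_j, y_j) on l_1, both below it in the order. In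
    the strip a - y <= x and y <= b - x, so for these generators one of the two filtration bounds
    implies the other; this is why each copy of W carries a single bound in [cocone_fil]. Exactness
    of the subquotient functor is then formal, whereas finite dimension and continuity become
    visible only through the exact sequence. *)

Definition linear_map V W (f : V -> W) (h : linear f) : {linear V -> W} :=
  HB.pack f (GRing.isLinear.Build F V W *:%R f h).

Lemma linear_mapE V W (f : V -> W) (h : linear f) x : linear_map h x = f x.
Proof. by []. Qed.

Definition submod V (P : V -> Prop) : Prop :=
  P 0 /\ forall c x y, P x -> P y -> P (c *: x + y).

(** A ternary closure condition names no direction space. The empty set qualifies, so nonemptiness
    is always a separate hypothesis. *)
Definition affine V (S : V -> Prop) : Prop :=
  forall c x y z, S x -> S y -> S z -> S (x + c *: (y - z)).

Section Submod.
Variables (V : lmodType F) (P : V -> Prop).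
Hypothesis hP : submod P.

Lemma submod0 : P 0. Proof. by case: hP. Qed.

Lemma submodD x y : P x -> P y -> P (x + y).
Proof. by move=> px py; rewrite -[x]scale1r; apply: hP.2. Qed.

Lemma submodZ c x : P x -> P (c *: x).
Proof. by move=> px; rewrite -[_ *: _]addr0; apply: hP.2 => //; exact: submod0. Qed.

Lemma submodN x : P x -> P (- x).
Proof. by rewrite -scaleN1r; exact: submodZ. Qed.

Lemma submodB x y : P x -> P y -> P (x - y).
Proof. by move=> px py; apply: submodD => //; exact: submodN. Qed.

Lemma submod_sum (I : eqType) (r : seq I) (Q : pred I) (E : I -> V) :
  (forall i, i \in r -> Q i -> P (E i)) -> P (\sum_(i <- r | Q i) E i).
Proof.
move=> h; rewrite big_seq_cond; apply: big_ind => [|x y px py|i /andP[ir qi]].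
- exact: submod0.
- exact: submodD.
- exact: h.
Qed.

End Submod.

Lemma affine_fiber V W (f : {linear V -> W}) y : affine (fun x => f x = y).
Proof.
move=> c x1 x2 x3 e1 e2 e3.
by rewrite linearD linearZ_LR linearB e1 e2 e3 subrr scaler0 addr0.
Qed.

(** A subspace of maximal dimension inside [P] exhausts it, since adding the line of a missing
    vector would enlarge it. This makes dimensions available for predicates. *)
Lemma submod_vspace (vT : vectType F) (P : vT -> Prop) :
  submod P -> exists U : {vspace vT}, forall x, (x \in U) <-> P x.
Proof.
move=> hP.
pose sub (U : {vspace vT}) := forall x, x \in U -> P x.
pose Q n := `[< exists U, sub U /\ \dim U = n >].
have exQ : exists n, Q n.
  exists 0%N; apply/asboolP; exists 0%VS; split; last exact: dimv0.
  by move=> x; rewrite memv0 => /eqP ->; exact: submod0.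
have bQ n : Q n -> (n <= \dim {:vT})%N.
  by move=> /asboolP[U [_ <-]]; exact/dimvS/subvf.
case: (ex_maxnP exQ bQ) => n /asboolP[U [sU dU]] mx.
exists U => x; split; first exact: sU.
move=> px.
have sUx : sub (U + <[x]>)%VS.
  move=> y /memv_addP[u uU [w /vlineP[c ->] ->]].
  by apply: submodD => //; [exact: sU | exact: submodZ].
have := mx _ (asboolT (ex_intro _ _ (conj sUx erefl))).
rewrite -dU => le.
have /eqP -> : (U == U + <[x]>)%VS by rewrite eqEdim addvSl le.
by apply: (subvP (addvSr U <[x]>)); exact: memv_line.
Qed.

Lemma fin_dim_cover V : fin_dim V ->
  exists (n : nat) (p : {linear 'rV[F]_n -> V}), forall x, exists r, p r = x.
Proof.
case=> n [e he].
have lin : linear (fun r : 'rV[F]_n => \sum_(i < n) r 0 i *: e i).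
  move=> c x y; rewrite scaler_sumr -big_split; apply: eq_bigr => i _.
  by rewrite !mxE scalerDl scalerA.
exists n, (linear_map lin) => x; have [c ->] := he x.
by exists (\row_i c i); apply: eq_bigr => i _; rewrite mxE.
Qed.

Lemma submod_preim V W (f : {linear V -> W}) (P : W -> Prop) :
  submod P -> submod (fun x => P (f x)).
Proof.
move=> hP; split=> [|c x y px py]; first by rewrite linear0; exact: submod0.
by rewrite linearP; apply: hP.2.
Qed.

(** A complement of the preimage of [P] in the covering space of row vectors meets that preimage
    only in 0, so its basis stays independent modulo [P]. *)
Lemma basis_mod V (P : V -> Prop) : fin_dim V -> submod P ->
  exists n (e : 'I_n -> V),
    (forall c : 'I_n -> F, P (\sum_i c i *: e i) -> forall i, c i = 0) /\
    (forall x, exists c : 'I_n -> F, P (x - \sum_i c i *: e i)).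
Proof.
move=> /fin_dim_cover[m [p hp]] hP.
have [U hU] := submod_vspace (submod_preim p hP).
pose B := vbasis (U^C)%VS.
have bB : basis_of (U^C)%VS B := vbasisP _.
exists (\dim (U^C)), (fun i => p B`_i); split.
- move=> c; rewrite -(eq_bigr _ (fun i _ => linearZ_LR p (c i) B`_i)) -linear_sum.
  move=> /hU inU; move/freeP: (basis_free bB); apply.
  have inC : \sum_(i < \dim U^C) c i *: B`_i \in (U^C)%VS.
    apply: memv_suml => i _; apply: memvZ; apply: (basis_mem bB).
    by apply: mem_nth; rewrite size_tuple.
  by apply/eqP; rewrite -memv0 -(capv_compl U) memv_cap inU.
- move=> x; have [r rx] := hp x.
  have : r \in (U + U^C)%VS by rewrite addv_complf memvf.
  move=> /memv_addP[u uU [w wC rE]].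
  exists (fun i => coord B i w).
  have <- : p w = \sum_i coord B i w *: p B`_i.
    rewrite {1}(coord_basis bB wC) linear_sum.
    by apply: eq_bigr => i _; rewrite linearZ.
  by rewrite -rx rE linearD addrK; apply/hU.
Qed.

Lemma indep_bound V : fin_dim V -> exists N, forall n (f : 'I_n -> V),
  (forall c : 'I_n -> F, \sum_i c i *: f i = 0 -> forall i, c i = 0) -> (n <= N)%N.
Proof.
case=> N [e he]; exists N => n f hf; rewrite leqNgt; apply/negP => ltNn.
have [A hA] := @choice _ _ (fun i (c : 'I_N -> F) => f i = \sum_k c k *: e k)
   (fun i => he (f i)).
pose M : 'M[F]_(n, N) := \matrix_(i, k) A i k.
have : kermx M != 0.
  rewrite kermx_eq0 /row_free neq_ltn; apply/orP; left.
  exact: leq_ltn_trans (rank_leq_col M) ltNn.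
case/rowV0Pn => v /sub_kermxP vM; apply/negP; rewrite negbK.
apply/eqP/matrixP => i0 i; rewrite (ord1 i0) [RHS]mxE; apply: (hf (fun i => v 0 i)).
under eq_bigr => j _ do rewrite hA scaler_sumr.
rewrite exchange_big big1 // => k _.
under eq_bigr => j _ do rewrite scalerA.
rewrite -scaler_suml.
have /matrixP/(_ 0 k) := vM; rewrite !mxE.
by under eq_bigr => j _ do rewrite mxE; move=> ->; rewrite scale0r.
Qed.

(** The chain is stationary from an index at which the dimension of the preimage is minimal. *)
Lemma submod_chain V (D : nat -> V -> Prop) : fin_dim V ->
  (forall n, submod (D n)) -> (forall n m x, (n <= m)%N -> D m x -> D n x) ->
  exists n, forall m x, (n <= m)%N -> D n x -> D m x.
Proof.
move=> /fin_dim_cover[N [p hp]] sD dD.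
have [U hU] := choice (fun n => submod_vspace (submod_preim p (sD n))).
pose Q d := `[< exists n, \dim (U n) = d >].
have exQ : exists d, Q d by exists (\dim (U 0)); apply/asboolP; exists 0%N.
case: (ex_minnP exQ) => d /asboolP[n dn] mn.
exists n => m x nm Dx; have [r rx] := hp x.
have sub : (U m <= U n)%VS by apply/subvP => y /hU/(dD _ _ _ nm) h; apply/hU.
have /eqP E : (U m == U n) by rewrite eqEdim sub dn mn //; apply/asboolP; exists m.
by rewrite -rx; apply/hU; rewrite E; apply/hU; rewrite rx.
Qed.

(** The sets of differences form a descending chain of subspaces. Once it is stationary, nested
    nonempty affine sets with equal directions coincide. *)
Lemma affine_chain V (D : nat -> V -> Prop) : fin_dim V ->
  (forall n, affine (D n)) -> (forall n, exists x, D n x) ->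
  (forall n m x, (n <= m)%N -> D m x -> D n x) ->
  exists n, forall m x, (n <= m)%N -> D n x -> D m x.
Proof.
move=> fV aD neD dD.
pose E n d := exists y z, [/\ D n y, D n z & d = y - z].
have sE n : submod (E n).
  split; first by have [x hx] := neD n; exists x, x; rewrite subrr.
  move=> c _ _ [y [z [dy dz ->]]] [y' [z' [dy' dz' ->]]].
  exists (y' + c *: (y - z)), z'; split=> //; first exact: aD.
  by rewrite addrA [c *: _ + _]addrC.
have dE n m d : (n <= m)%N -> E m d -> E n d.
  by move=> nm [y [z [dy dz ->]]]; exists y, z; split=> //; exact: dD nm _.
have [n hn] := submod_chain fV sE dE.
exists n => m x nm Dx; have [w Dw] := neD m.
have : E n (x - w) by exists x, w; split=> //; exact: dD nm _.
move=> /(hn _ _ nm)[y [z [dy dz xwE]]].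
have -> : x = w + 1 *: (y - z) by rewrite scale1r -xwE addrC subrK.
exact: aD.
Qed.

(** [r] is the graph of a functional on a subspace. The extension is 0 on a basis modulo the domain,
    and [q] is its graph. *)
Lemma functional_extension V (r : V -> F -> Prop) : fin_dim V ->
  r 0 0 -> (forall k x c y d, r x c -> r y d -> r (k *: x + y) (k * c + d)) ->
  (forall c, r 0 c -> c = 0) ->
  exists g : {linear V -> F^o}, forall x c, r x c -> g x = c.
Proof.
move=> fV r0 rD rf.
have sP : submod (fun x => exists c, r x c).
  split; first by exists 0.
  by move=> k x y [c hc] [d hd]; exists (k * c + d); exact: rD.
have [n [e [ei es]]] := basis_mod fV sP.
have rfun x c d : r x c -> r x d -> c = d.
  move=> h1 h2; have := rD (-1) _ _ _ _ h1 h2; rewrite scaleN1r addNr mulN1r.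
  by move=> /rf/eqP; rewrite addrC subr_eq0 => /eqP.
pose q x c := exists k : 'I_n -> F, r (x - \sum_i k i *: e i) c.
have qD k x c y d : q x c -> q y d -> q (k *: x + y) (k * c + d).
  move=> [u hu] [w hw]; exists (fun i => k * u i + w i).
  have := rD k _ _ _ _ hu hw; congr (r _ _).
  under [in RHS]eq_bigr => i _ do rewrite scalerDl -scalerA.
  by rewrite big_split -scaler_sumr /= scalerBr opprD addrACA.
have qfun x c d : q x c -> q x d -> c = d.
  move=> [u hu] [w hw].
  have := rD (-1) _ _ _ _ hu hw; rewrite scaleN1r opprB addrA subrK.
  rewrite -sumrB; under eq_bigr => i _ do rewrite -scalerBl.
  move=> h; have uw := ei (fun i => u i - w i) (ex_intro _ _ h).
  move: h; rewrite big1 => [/rf/eqP|i _]; last by rewrite uw scale0r.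
  by rewrite mulN1r addrC subr_eq0 => /eqP.
have qex x : exists c, q x c by have [k [c hc]] := es x; exists c, k.
have [g hg] := choice qex.
have lg : linear (g : V -> F^o).
  by move=> c x y; apply: qfun (hg _) _; exact: qD.
exists (linear_map lg) => x c rx; apply: qfun (hg x) _.
by exists (fun=> 0); rewrite big1 ?subr0 // => i _; rewrite scale0r.
Qed.

End LinearAlgebra.

(** * Structure maps on the strip *)

Section Points.
Variables (R : realType) (a b : R).
Implicit Types u v w : pt a b.

Definition px u := (sval u).1.
Definition py u := (sval u).2.

Lemma px_py_ge u : a <= px u + py u.
Proof. by case/andP: (proj2_sig u). Qed.

Lemma px_py_le u : px u + py u <= b.
Proof. by case/andP: (proj2_sig u). Qed.

Lemma pt_eq u v : px u = px v -> py u = py v -> u = v.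
Proof.
move=> ex ey; apply: val_inj.
by rewrite [LHS]surjective_pairing [RHS]surjective_pairing; congr pair.
Qed.

Lemma pleE u v : ple u v = (px v <= px u) && (py u <= py v).
Proof. by []. Qed.

Lemma ple_intro u v : px v <= px u -> py u <= py v -> ple u v.
Proof. by rewrite pleE => -> ->. Qed.

Lemma ple_px u v : ple u v -> px v <= px u. Proof. by case/andP. Qed.
Lemma ple_py u v : ple u v -> py u <= py v. Proof. by case/andP. Qed.

Lemma ple_refl u : ple u u. Proof. by rewrite pleE !lexx. Qed.

Lemma ple_trans v u w : ple u v -> ple v w -> ple u w.
Proof.
rewrite !pleE => /andP[h1 h2] /andP[h3 h4].
by rewrite (le_trans h3 h1) (le_trans h2 h4).
Qed.

Lemma pt_make x y : a <= x + y -> x + y <= b -> {u | px u = x /\ py u = y}.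
Proof.
move=> h1 h2; have h : inM a b (x, y) by rewrite /inM h1 h2.
by exists (exist _ (x, y) h).
Qed.

(** The support of the contravariant block with top element [v]: the rectangle
    of the [u <= v] that are not separated from [v] by a boundary point. *)
Definition supp v u := [&& ple u v, a < px v + py u & px u + py v < b].

Lemma supp_ple v u : supp v u -> ple u v. Proof. by case/and3P. Qed.

End Points.

Section Maps.
Variables (R : realType) (a b : R) (F : fieldType).
Implicit Types (u v w : pt a b) (G H X : pmod a b F).

Lemma rmapE G u v (h : ple u v) x : rmap u x = pm_map G h x.
Proof.
(* Generalising the boolean together with its equation allows case analysis under the dependent
   match. *)
suff : forall c (e : ple u v = c),
    (if c as c return ple u v = c -> pm_obj G u
     then fun h => pm_map G h x else fun=> 0) e = pm_map G h x by exact.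
case=> e; first by rewrite (bool_irrelevance e h).
by exfalso; rewrite h in e.
Qed.

Lemma rmap0out G u v (x : pm_obj G v) : ~~ ple u v -> rmap u x = 0.
Proof.
move=> /negbTE h.
suff : forall c (e : ple u v = c),
    (if c as c return ple u v = c -> pm_obj G u
     then fun h => pm_map G h x else fun=> 0) e = 0 by exact.
by case=> e //; exfalso; rewrite e in h.
Qed.

Lemma rmap_linear G u v : linear (@rmap _ a b F G u v).
Proof.
move=> c x y; case: (boolP (ple u v)) => h; first by rewrite !(rmapE h) linearP.
by rewrite !rmap0out // scaler0 addr0.
Qed.

HB.instance Definition _ G u v :=
  GRing.isLinear.Build F _ _ *:%R (@rmap _ a b F G u v) (@rmap_linear G u v).

Lemma rmap0 G u v : rmap u (0 : pm_obj G v) = 0.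
Proof. exact: linear0. Qed.

Lemma rmapD G u v (x y : pm_obj G v) : rmap u (x + y) = rmap u x + rmap u y.
Proof. exact: linearD. Qed.

Lemma rmapB G u v (x y : pm_obj G v) : rmap u (x - y) = rmap u x - rmap u y.
Proof. exact: linearB. Qed.

Lemma rmapZ G u v c (x : pm_obj G v) : rmap u (c *: x) = c *: rmap u x.
Proof. exact: linearZ. Qed.

Lemma rmap_sum G u v I (r : seq I) (P : pred I) (E : I -> pm_obj G v) :
  rmap u (\sum_(i <- r | P i) E i) = \sum_(i <- r | P i) rmap u (E i).
Proof. exact: linear_sum. Qed.

Lemma rmap_id G u (x : pm_obj G u) : rmap u x = x.
Proof. by rewrite (rmapE (ple_refl u)) pm_id. Qed.

Lemma rmap_comp G v u w (x : pm_obj G w) : ple u v -> ple v w ->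
  rmap u (rmap v x) = rmap u x.
Proof.
move=> uv vw; rewrite (rmapE vw) (rmapE uv) (rmapE (ple_trans uv vw)).
exact: pm_comp.
Qed.

Lemma pmor_rmap G H (f : pmor G H) u v (x : pm_obj G v) :
  pmor_fun f u (rmap u x) = rmap u (pmor_fun f v x).
Proof.
case: (boolP (ple u v)) => h; first by rewrite !(rmapE h) pmor_nat.
by rewrite !rmap0out // linear0.
Qed.

Definition pmor_comp G H X (g : pmor H X) (f : pmor G H) : pmor G X.
Proof.
exists (fun u => (pmor_fun g u \o pmor_fun f u) : {linear pm_obj G u -> pm_obj X u}).
by move=> u v h x; rewrite /= !pmor_nat.
Defined.

Lemma pmor_make G H (f : forall u, pm_obj G u -> pm_obj H u) :
  (forall u, linear (f u)) ->
  (forall u v (x : pm_obj G v), ple u v -> f u (rmap u x) = rmap u (f v x)) ->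
  exists g : pmor G H, forall u x, pmor_fun g u x = f u x.
Proof.
move=> lf nf.
suff nat u v (h : ple u v) (x : pm_obj G v) :
    linear_map (lf u) (pm_map G h x) = pm_map H h (linear_map (lf v) x).
  by exists (PMor nat).
by rewrite !linear_mapE -!rmapE nf.
Qed.

(** When [u] precedes [v], either inequality puts a boundary point, (a - py u, py u) or (px u, b -
    px u), between them, and the map factors through its zero space. *)
Lemma rmap_bd G u v (x : pm_obj G v) : vanishes_on_bd G ->
  px v + py u <= a \/ b <= px u + py v -> rmap u x = 0.
Proof.
move=> vG h; case: (boolP (ple u v)) => [uv|]; last exact: rmap0out.
have := px_py_ge u; have := px_py_ge v; have := px_py_le u; have := px_py_le v.
have := ple_px uv; have := ple_py uv => h1 h2 h3 h4 h5 h6.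
case: h => h.
- have [||q [qx qy]] := @pt_make _ a b (a - py u) (py u); [lra|lra|].
  have uq : ple u q by apply: ple_intro; lra.
  have qv : ple q v by apply: ple_intro; lra.
  rewrite -(rmap_comp x uq qv).
  have -> : rmap q x = 0 by apply: vG; left; rewrite -/(px q) -/(py q) qx qy; lra.
  exact: linear0.
- have [||q [qx qy]] := @pt_make _ a b (px u) (b - px u); [lra|lra|].
  have uq : ple u q by apply: ple_intro; lra.
  have qv : ple q v by apply: ple_intro; lra.
  rewrite -(rmap_comp x uq qv).
  have -> : rmap q x = 0 by apply: vG; right; rewrite -/(px q) -/(py q) qx qy; lra.
  exact: linear0.
Qed.

Lemma rmap_unsupp G u v (x : pm_obj G v) : vanishes_on_bd G ->
  ~~ supp v u -> rmap u x = 0.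
Proof.
move=> vG; case: (boolP (ple u v)) => [uv|]; last by move/rmap0out.
rewrite /supp uv /= negb_and -!leNgt => /orP h.
exact: rmap_bd.
Qed.

(** The rectangle has its corner (px q, py r) on l_1; in [exact_vertical] the corner (px r, py q) is
    on l_0. Since T exchanges horizontal and vertical sides, these two conditions express exactness
    of the long sequence at every term. *)
Definition exact_horizontal G : Prop := forall p q r : pt a b,
  py q = py p -> px p <= px q -> px r = px p -> py r = b - px q ->
  exact_at (@rmap _ a b F G p r) (@rmap _ a b F G q p).

Definition exact_vertical G := forall p q r : pt a b,
  px q = px p -> py q <= py p -> py r = py p -> px r = a - py q ->
  exact_at (@rmap _ a b F G p r) (@rmap _ a b F G q p).

(** T^2 is the translation by (-(b - a), b - a). So T^k is a translation for even k and T followed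
    by a translation for odd k, and [c] records the translation. *)
Lemma Tz_coord (k : int) : exists c : R,
  (forall u, [/\ px (Tz k u) = px u - c, py (Tz k u) = py u + c,
     px (Tz (k + 1) u) = a - py u - c, py (Tz (k + 1) u) = b - px u + c
   & px (Tz (k - 1) u) = b - py u - c /\ py (Tz (k - 1) u) = a - px u + c]) \/
  (forall u, [/\ px (Tz k u) = a - py u - c, py (Tz k u) = b - px u + c,
     px (Tz (k + 1) u) = px u - c - (b - a),
     py (Tz (k + 1) u) = py u + c + (b - a)
   & px (Tz (k - 1) u) = px u - c /\ py (Tz (k - 1) u) = py u + c]).
Proof.
have S (j : int) u : Tz (j + 1) u = Tmap (Tz j u).
  case: j => [n|[|n]] //.
  - by rewrite -PoszD addn1.
  - by apply: pt_eq; rewrite /px /py /=; lra.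
  - have -> : Negz n.+1 + 1 = Negz n by rewrite !NegzE; lra.
    by apply: pt_eq; rewrite /px /py /=; lra.
have P (j : int) u : Tz (j - 1) u = Tinv (Tz j u).
  have := S (j - 1) u; rewrite subrK => ->.
  by apply: pt_eq; rewrite /px /py /=; lra.
have Q (j : int) : exists c : R,
  (forall u, px (Tz j u) = px u - c /\ py (Tz j u) = py u + c) \/
  (forall u, px (Tz j u) = a - py u - c /\ py (Tz j u) = b - px u + c).
  have up : forall n : nat, exists c : R,
    (forall u, px (Tz n u) = px u - c /\ py (Tz n u) = py u + c) \/
    (forall u, px (Tz n u) = a - py u - c /\ py (Tz n u) = b - px u + c).
    elim=> [|n [c IH]]; first by exists 0; left=> u /=; split; lra.
    case: IH => IH; [exists c; right=> u | exists (c + (b - a)); left=> u];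
      by have := IH u; rewrite -addn1 PoszD S /px /py /= => -[-> ->]; split; lra.
  have down : forall n : nat, exists c : R,
    (forall u, px (Tz (- n%:Z) u) = px u - c /\ py (Tz (- n%:Z) u) = py u + c) \/
    (forall u, px (Tz (- n%:Z) u) = a - py u - c /\
               py (Tz (- n%:Z) u) = b - px u + c).
    elim=> [|n [c IH]]; first by exists 0; left=> u /=; split; lra.
    case: IH => IH; [exists (c - (b - a)); right=> u | exists c; left=> u];
      by have := IH u; rewrite -addn1 PoszD opprD P /px /py /= => -[-> ->];
         split; lra.
  by case: j => n; [exact: up | rewrite NegzE; exact: down].
have [c hc] := Q k; exists c; case: hc => hc; [left|right]=> u;
  by rewrite S P; have := hc u; rewrite /px /py /= => -[-> ->];
     repeat split; lra.
Qed.

Lemma cohomologicalE G : cohomological G <->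
  [/\ vanishes_on_bd G, exact_horizontal G & exact_vertical G].
Proof.
split=> [[vG eG]|[vG hG eG]].
- split=> // p q r e1 e2 e3 e4.
  + have h5 : (sval q).1 + (sval r).2 = b by rewrite -/(px q) -/(py r) e4; lra.
    have h4 : (sval p).2 <= (sval r).2.
      by rewrite -/(py p) -/(py r) e4; have := px_py_le q; rewrite e1; lra.
    exact: (eG q p r e1 (esym e3) e2 h4 h5 0).1.
  + have h1 := px_py_le q; have h2 := px_py_ge q.
    have h3 := px_py_le p; have h4 := px_py_ge p.
    (* The sides through p = u and r = v are completed to a rectangle by the point w with T^{-1} w =
       q. *)
    have [||w [wx wy]] := @pt_make _ a b (px r) (b - px p); [lra|lra|].
    have k1 : (sval p).2 = (sval r).2 by rewrite -/(py p) -/(py r) e3.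
    have k2 : (sval r).1 = (sval w).1 by rewrite -/(px r) -/(px w) wx.
    have k3 : (sval r).1 <= (sval p).1 by rewrite -/(px r) -/(px p); lra.
    have k4 : (sval r).2 <= (sval w).2 by rewrite -/(py r) -/(py w); lra.
    have k5 : (sval p).1 + (sval w).2 = b by rewrite -/(px p) -/(py w); lra.
    have [_ [+ _]] := eG p r w k1 k2 k3 k4 k5 0.
    suff -> : Tz (0 - 1) w = q by [].
    by apply: pt_eq; rewrite /px /py /= -/(px w) -/(py w); lra.
- split=> // u v w; rewrite -/(px u) -/(px v) -/(px w) -/(py u) -/(py v) -/(py w).
  move=> e1 e2 e3 e4 e5 k; have h1 := px_py_ge v.
  have [c [hc|hc]] := Tz_coord k.
  + have [ux uy ux' uy' [ux'' uy'']] := hc u.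
    have [vx vy vx' vy' [vx'' vy'']] := hc v.
    have [wx wy wx' wy' [wx'' wy'']] := hc w.
    split; [|split].
    * by apply: hG; lra.
    * by apply: eG; lra.
    * by apply: eG; lra.
  + have [ux uy ux' uy' [ux'' uy'']] := hc u.
    have [vx vy vx' vy' [vx'' vy'']] := hc v.
    have [wx wy wx' wy' [wx'' wy'']] := hc w.
    split; [|split].
    * by apply: eG; lra.
    * by apply: hG; lra.
    * by apply: hG; lra.
Qed.

End Maps.

(** * Inverse limits along increasing sequences of points *)

Section Limits.
Local Open Scope classical_set_scope.
Variables (R : realType) (a b : R) (F : fieldType).
Implicit Types (u v w p : pt a b) (G : pmod a b F).

Lemma ple_seq (us : nat -> pt a b) : (forall k, ple (us k) (us k.+1)) ->
  forall m n, (m <= n)%N -> ple (us m) (us n).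
Proof.
move=> h m n /subnK <-; elim: (n - m)%N => [|k IH]; first exact: ple_refl.
by rewrite addSn; apply: ple_trans (h _).
Qed.

(** Mittag-Leffler: the stable images of the [S k] are nonempty because descending
    chains of affine subspaces of a finite-dimensional space are stationary. *)
Lemma tower_point G (us : nat -> pt a b) (S : forall k, pm_obj G (us k) -> Prop) :
  pfd G -> (forall k, ple (us k) (us k.+1)) ->
  (forall k, affine (S k)) -> (forall k, exists x, S k x) ->
  (forall k x, S k.+1 x -> S k (rmap (us k) x)) ->
  exists xs : forall k, pm_obj G (us k),
    forall k, S k (xs k) /\ rmap (us k) (xs k.+1) = xs k.
Proof.
move=> fG incr aS neS resS.
have le_us := ple_seq incr.
have resS' k m x : (k <= m)%N -> S m x -> S k (rmap (us k) x).
  elim: m x => [|m IH] x km sx; first by case: k km => // _; rewrite rmap_id.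
  move: km; rewrite leq_eqVlt => /orP[/eqP ->|km]; first by rewrite rmap_id.
  by rewrite -(@rmap_comp _ _ _ _ G (us m)) //; [exact/IH/resS | exact: le_us].
pose D k m x := exists2 y, S m y & x = rmap (us k) y.
have stD k : exists n, forall m x, (n <= m)%N -> D k (k + n)%N x -> D k (k + m)%N x.
  apply: (@affine_chain _ _ (fun m => D k (k + m)%N)); first exact: fG.
  - move=> m c _ _ _ [x sx ->] [y sy ->] [z sz ->].
    by exists (x + c *: (y - z)); [exact: aS | rewrite rmapD rmapZ rmapB].
  - by move=> m; have [y sy] := neS (k + m)%N; exists (rmap (us k) y), y.
  - move=> m n x mn [y sy ->]; exists (rmap (us (k + m)%N) y).
      by apply: resS' sy; rewrite leq_add2l.
    by rewrite rmap_comp //; apply: le_us; rewrite ?leq_addr ?leq_add2l.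
pose St k x := forall m, D k (k + m)%N x.
have dD k m n x : (m <= n)%N -> D k (k + n)%N x -> D k (k + m)%N x.
  move=> mn [y sy ->]; exists (rmap (us (k + m)%N) y).
    by apply: resS' sy; rewrite leq_add2l.
  by rewrite rmap_comp //; apply: le_us; rewrite ?leq_addr ?leq_add2l.
have stable k : exists n, forall x, D k (k + n)%N x -> St k x.
  have [n hn] := stD k; exists n => x hx m; case: (leqP n m) => nm.
    exact: hn nm hx.
  exact: dD (ltnW nm) hx.
have st0 : exists x, St 0%N x.
  have [n hn] := stable 0%N; have [y sy] := neS (0 + n)%N.
  by exists (rmap (us 0%N) y); apply: hn; exists y.
have stS k (s : {x | St k x}) : exists y, St k.+1 y /\ rmap (us k) y = sval s.
  have [n hn] := stable k.+1; case: s => x /= /(_ n.+1).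
  rewrite addnS -addSn => -[y sy ->]; exists (rmap (us k.+1) y); split.
    by apply: hn; exists y.
  by rewrite rmap_comp //; apply: le_us; rewrite leq_addr.
pose xs := nat_rect (fun k => {x | St k x})
  (exist _ (sval (cid st0)) (proj2_sig (cid st0)))
  (fun k s => exist _ (sval (cid (stS k s))) (proj1 (proj2_sig (cid (stS k s))))).
exists (fun k => sval (xs k)) => k; split; last first.
  exact: (proj2 (proj2_sig (cid (stS k (xs k))))).
have := proj2_sig (xs k) 0%N; rewrite /D addn0 => -[y sy ->].
by rewrite rmap_id.
Qed.

(** Vanishing of lim^1 in the form used below: compatible nonempty affine conditions along the
    sequence have a common solution at the limit. *)
Lemma seq_limit_point G (us : nat -> pt a b) u
    (S : forall k, pm_obj G (us k) -> Prop) :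
  pfd G -> seq_continuous G -> (forall k, ple (us k) (us k.+1)) ->
  ((fun k => sval (us k)) @ \oo --> sval u) ->
  (forall k, affine (S k)) -> (forall k, exists x, S k x) ->
  (forall k x, S k.+1 x -> S k (rmap (us k) x)) ->
  exists x : pm_obj G u, forall k, S k (rmap (us k) x).
Proof.
move=> fG cG incr cvu aS neS resS.
have [xs hxs] := tower_point fG incr aS neS resS.
have [|x hx] := (cG us u incr cvu).2 xs; first by move=> k; case: (hxs k).
by exists x => k; rewrite hx; case: (hxs k).
Qed.

(** The images of the G(us k) in G(p) become stationary. An element of the stable image outside [K]
    has nonempty affine fibres at all levels, and so lifts to the limit. *)
Lemma limit_image_escapes G (us : nat -> pt a b) u p (K : pm_obj G p -> Prop) :
  pfd G -> seq_continuous G -> (forall k, ple (us k) (us k.+1)) ->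
  ((fun k => sval (us k)) @ \oo --> sval u) ->
  (forall k, ple p (us k)) -> (forall k, ple (us k) u) ->
  (forall k, exists x : pm_obj G (us k), ~ K (rmap p x)) ->
  exists x : pm_obj G u, ~ K (rmap p x).
Proof.
move=> fG cG incr cvu pu uu nK.
pose D k z := exists x : pm_obj G (us k), z = rmap p x.
have [||n hn] := @submod_chain _ _ D (fG p).
- move=> k; split; first by exists 0; rewrite rmap0.
  by move=> c _ _ [x ->] [y ->]; exists (c *: x + y); rewrite rmapD rmapZ.
- move=> k m x km [y ->]; exists (rmap (us k) y).
  by rewrite rmap_comp //; exact: (ple_seq incr).
have [x0 nKx0] := nK n.
have [|||x hx] := @seq_limit_point G us u (fun k y => rmap p y = rmap p x0)
  fG cG incr cvu.
- by move=> k; exact: (@affine_fiber _ _ _ (@rmap _ a b F G p (us k) : {linear _ -> _})).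
- move=> k; have Dn : D n (rmap p x0) by exists x0.
  have [nk|kn] := leqP n k; first by have [y ->] := hn _ _ nk Dn; exists y.
  exists (rmap (us k) x0); rewrite rmap_comp //.
  by apply: (ple_seq incr); exact: ltnW.
- by move=> k x <-; rewrite rmap_comp.
exists x; have := hx 0%N; rewrite rmap_comp // => ->.
exact: nKx0.
Qed.

Lemma convex_pt u v (t : R) : 0 <= t -> t <= 1 ->
  {w : pt a b | px w = px u + t * (px v - px u) /\ py w = py u + t * (py v - py u)}.
Proof.
move=> t0 t1; apply: pt_make.
- have := mulr_ge0 t0 (_ : 0 <= px v + py v - a).
  have := mulr_ge0 (_ : 0 <= 1 - t) (_ : 0 <= px u + py u - a).
  by rewrite !subr_ge0 !px_py_ge t1 => /(_ isT isT) h1 /(_ isT) h2; lra.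
- have := mulr_ge0 t0 (_ : 0 <= b - (px v + py v)).
  have := mulr_ge0 (_ : 0 <= 1 - t) (_ : 0 <= b - (px u + py u)).
  by rewrite !subr_ge0 !px_py_le t1 => /(_ isT isT) h1 /(_ isT) h2; lra.
Qed.

(** The parameters at which some element escapes [K] are closed downwards. A positive supremum t is
    attained by continuity along the parameters t(1 - 1/(k+1)); the parameter 0 escapes by
    hypothesis. *)
Lemma last_escaping_point G u v p (K : pm_obj G p -> Prop) :
  pfd G -> seq_continuous G -> ple p u -> ple u v ->
  (exists x : pm_obj G u, ~ K (rmap p x)) ->
  exists t, [/\ 0 <= t, t <= 1,
   (forall w, px w = px u + t * (px v - px u) -> py w = py u + t * (py v - py u) ->
     exists x : pm_obj G w, ~ K (rmap p x)) &
   forall s w, t < s -> s <= 1 -> 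
     px w = px u + s * (px v - px u) -> py w = py u + s * (py v - py u) ->
     forall x : pm_obj G w, K (rmap p x)].
Proof.
move=> fG cG pu uv nKu.
have uvx := ple_px uv; have uvy := ple_py uv.
have dx : 0 <= px u - px v by lra.
have dy : 0 <= py v - py u by lra.
pose E : set R := [set t | [/\ 0 <= t, t <= 1 & exists w,
   [/\ px w = px u + t * (px v - px u), py w = py u + t * (py v - py u)
     & exists x : pm_obj G w, ~ K (rmap p x)]]].
have E0 : E 0.
  by split=> //; exists u; split=> //; rewrite mul0r addr0.
have ubE : ubound E 1 by move=> t [].
have hE : has_sup E by split; [exists 0 | exists 1].
pose t := sup E.
have supE s : E s -> s <= t by move=> Es; exact: (sup_upper_bound hE).
have t0 : 0 <= t by exact: supE.
have t1 : t <= 1 by apply: ge_sup => //; exists 0.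
have mono (s r : R) w : 0 <= s -> s <= r -> E r -> 
    px w = px u + s * (px v - px u) -> py w = py u + s * (py v - py u) ->
    exists x : pm_obj G w, ~ K (rmap p x).
  move=> s0 sr [_ _ [w' [wx' wy' [x hx]]]] wx wy.
  have m1 := ler_wpM2r dx sr; have m2 := ler_wpM2r dy sr.
  have m3 := mulr_ge0 s0 dx; have m4 := mulr_ge0 s0 dy.
  have ww' : ple w w' by apply: ple_intro; lra.
  have pw : ple p w by apply: ple_trans pu _; apply: ple_intro; lra.
  by exists (rmap w x); rewrite rmap_comp.
exists t; split=> //; last first.
  move=> s w ts s1 wx wy x; apply: contrapT => nK.
  have : s <= t; last by rewrite leNgt ts.
  apply: supE.
  split=> //; first by apply/ltW/(le_lt_trans t0).
  by exists w; split=> //; exists x.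
move=> w wx wy.
have [t00|tn0] := eqVneq t 0; first by apply: (mono t 0) => //; rewrite t00.
have tp : 0 < t by rewrite lt_def tn0.
pose th (k : nat) : R := t * (1 - harmonic k).
have h0 k : 0 < harmonic k :> R by rewrite invr_gt0.
have h1 k : harmonic k <= 1 :> R by rewrite invf_le1 // ler1n.
have th0 k : 0 <= th k by rewrite mulr_ge0 // subr_ge0.
have tht k : th k < t by rewrite /th gtr_pMr // gtrBl.
have th1 k : th k <= 1 by apply: le_trans t1; exact: ltW.
have thS k : th k <= th k.+1.
  by rewrite /th ler_pM2l // lerD2l lerN2 lef_pV2 ?posrE // ler_nat.
pose us k := sval (convex_pt u v (th0 k) (th1 k)).
have [usx usy] : (forall k, px (us k) = px u + th k * (px v - px u)) /\
                 (forall k, py (us k) = py u + th k * (py v - py u)).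
  by split=> k; rewrite /us; case: (convex_pt _ _ _ _) => z [].
have usw k : ple (us k) w.
  have m1 := ler_wpM2r dx (ltW (tht k)); have m2 := ler_wpM2r dy (ltW (tht k)).
  by apply: ple_intro; rewrite ?usx ?usy; lra.
apply: (@limit_image_escapes G us w p K) => //.
- move=> k; have m1 := ler_wpM2r dx (thS k); have m2 := ler_wpM2r dy (thS k).
  by apply: ple_intro; rewrite ?usx ?usy; lra.
- have cth : th @ \oo --> t.
    suff : th @ \oo --> t * (1 - 0) by rewrite subr0 mulr1.
    apply: cvgM; first exact: cvg_cst.
    by apply: cvgB; [exact: cvg_cst | exact: cvg_harmonic].
  have -> : (fun k => sval (us k)) = 
      (fun k => (px u + th k * (px v - px u), py u + th k * (py v - py u))).
    by apply/funext => k; rewrite [LHS]surjective_pairing -/(px _) -/(py _) usx usy.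
  rewrite [sval w]surjective_pairing -/(px _) -/(py _) wx wy.
  apply: (@cvg_pair _ _ _ _ (nbhs (px u + t * (px v - px u)))
    (nbhs (py u + t * (py v - py u)))) => /=.
  + by apply: cvgD; [exact: cvg_cst | apply: cvgM; [exact: cth | exact: cvg_cst]].
  + by apply: cvgD; [exact: cvg_cst | apply: cvgM; [exact: cth | exact: cvg_cst]].
- move=> k; apply: ple_trans pu _.
  have m3 := mulr_ge0 (th0 k) dx; have m4 := mulr_ge0 (th0 k) dy.
  by apply: ple_intro; rewrite ?usx ?usy; lra.
- move=> k; have d0 : 0 < t - th k by rewrite subr_gt0.
  have [e Ee te] := sup_adherent d0 hE.
  by apply: (mono (th k) e) => //; apply: ltW; move: te; rewrite subKr.
Qed.

End Limits.

(** * Block decompositions *)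

Lemma seq_bound (R : realType) (I : eqType) (f : I -> R) (s : seq I) (m M : R) :
  m < M -> (forall i, i \in s -> f i < M) ->
  exists c, [/\ m <= c, c < M & forall i, i \in s -> f i <= c].
Proof.
move=> mM; elim: s => [|i s IH] h; first by exists m.
have [j js|c [mc cM hc]] := IH; first by apply: h; rewrite in_cons js orbT.
exists (Num.max c (f i)); split.
- by rewrite le_max mc.
- by rewrite gt_max cM h // mem_head.
- by move=> j; rewrite in_cons le_max => /orP[/eqP ->|/hc ->]; rewrite ?lexx ?orbT.
Qed.

Lemma lex_max (R : realType) (I : eqType) (f g : I -> R) (s : seq I) i0 :
  i0 \in s -> exists2 i, i \in s &
    forall j, j \in s -> f j < f i \/ f j = f i /\ g i <= g j.
Proof.
elim: s i0 => // k s IH i0 _; case: s IH => [_|l s IH].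
  by exists k => [|j]; rewrite ?mem_head // inE => /eqP ->; right.
have [i is_ hi] := IH l (mem_head _ _).
have [lt|gt|e] := ltgtP (f k) (f i).
- exists i => [|j]; first by rewrite in_cons is_ orbT.
  by rewrite in_cons => /orP[/eqP ->|/hi//]; left.
- exists k => [|j]; first exact: mem_head.
  rewrite in_cons => /orP[/eqP ->|/hi[h|[h _]]]; first by right.
  + by left; exact: lt_trans gt.
  + by left; rewrite h.
- have [le|lt] := leP (g i) (g k).
  + exists i => [|j]; first by rewrite in_cons is_ orbT.
    by rewrite in_cons => /orP[/eqP ->|/hi//]; right.
  + exists k => [|j]; first exact: mem_head.
    rewrite in_cons => /orP[/eqP ->|/hi[h|[h h']]]; first by right.
    * by left; rewrite e.
    * by right; rewrite h e; split=> //; apply: ltW; exact: lt_le_trans h'.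
Qed.

Ltac strip_lra :=
  repeat match goal with
  | H : is_true (ple _ _) |- _ => clear H
  | H : is_true (supp _ _) |- _ => clear H
  | H : @eq (GRing.Lmodule.sort _) _ _ |- _ => clear H
  | H : forall _, _ |- _ => clear H
  end; lra.

(** * The radical of G(v) and linear relations between generators *)

Section Radical.
Variables (R : realType) (a b : R) (F : fieldType) (G : pmod a b F).
Implicit Types u v w p : pt a b.

(** The alternative z = 0 covers the case that no source satisfies [Q], such as the left side of a
    point of l_0. *)
Definition image_from (Q : pt a b -> Prop) v (z : pm_obj G v) :=
  z = 0 \/ exists w (x : pm_obj G w), Q w /\ z = rmap v x.

Lemma submod_image_from (Q : pt a b -> Prop) v :
  (forall w, Q w -> ple v w) ->
  (forall w w', Q w -> Q w' -> ple w w' \/ ple w' w) ->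
  submod (@image_from Q v).
Proof.
move=> Qv Qt; split; first by left.
move=> c y z [->|[w [x [Qw ->]]]] [->|[w' [x' [Qw' ->]]]].
- by rewrite scaler0 addr0; left.
- by right; exists w', x'; rewrite scaler0 add0r.
- by right; exists w, (c *: x); rewrite addr0 rmapZ.
- right; have [h|h] := Qt _ _ Qw Qw'.
  + exists w, (c *: x + rmap w x').
    by rewrite rmapD rmapZ rmap_comp //; exact: Qv.
  + exists w', (c *: rmap w' x + x').
    by rewrite rmapD rmapZ rmap_comp //; exact: Qv.
Qed.

Definition left_of v w := py w = py v /\ px w < px v.
Definition above v w := px w = px v /\ py v < py w.

(** In a block decomposition this is the part of G(v) contributed by blocks whose top is not [v];
    the generators at [v] will be a basis modulo it. *)
Definition radical v (z : pm_obj G v) := exists z1 z2,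
  [/\ image_from (left_of v) z1, image_from (above v) z2 & z = z1 + z2].

Lemma submod_left v : submod (@image_from (left_of v) v).
Proof.
apply: submod_image_from => [w [e l]|w w' [e l] [e' l']].
  by apply: ple_intro; rewrite ?e // ltW.
by case: (leP (px w') (px w)) => h; [left|right];
  apply: ple_intro; rewrite ?e ?e' // ltW.
Qed.

Lemma submod_above v : submod (@image_from (above v) v).
Proof.
apply: submod_image_from => [w [e l]|w w' [e l] [e' l']].
  by apply: ple_intro; rewrite ?e // ltW.
by case: (leP (py w) (py w')) => h; [left|right];
  apply: ple_intro; rewrite ?e ?e' // ltW.
Qed.

Lemma submod_radical v : submod (@radical v).
Proof.
have sL := submod_left v; have sU := submod_above v; split.
  by exists 0, 0; split; [exact: submod0 | exact: submod0 | rewrite addr0].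
move=> c _ _ [x1 [x2 [l1 l2 ->]]] [y1 [y2 [m1 m2 ->]]].
exists (c *: x1 + y1), (c *: x2 + y2); split; first exact: sL.2.
  exact: sU.2.
by rewrite scalerDr addrACA.
Qed.

Hypothesis vG : vanishes_on_bd G.

(** The map factors through (px w, py v) or (px v, py w), or it is 0 when that point lies on or
    beyond the boundary. *)
Lemma radical_rmap v w (x : pm_obj G w) : ple v w -> px w < px v \/ py v < py w ->
  radical (rmap v x).
Proof.
move=> vw h; have hx := ple_px vw; have hy := ple_py vw.
have sL := submod_left v; have sU := submod_above v.
have h1 := px_py_le v; have h2 := px_py_ge v.
case: h => h.
- exists (rmap v x), 0; split; [|exact: submod0|by rewrite addr0].
  have [le|gt] := leP (px w + py v) a; first by left; apply: rmap_bd => //; left.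
  have [||q [qx qy]] := @pt_make _ a b (px w) (py v); [strip_lra|strip_lra|].
  right; exists q, (rmap q x); split; first by split; strip_lra.
  by rewrite rmap_comp //; apply: ple_intro; strip_lra.
- exists 0, (rmap v x); split; [exact: submod0| |by rewrite add0r].
  have [le|gt] := leP b (px v + py w); first by left; apply: rmap_bd => //; right.
  have [||q [qx qy]] := @pt_make _ a b (px v) (py w); [strip_lra|strip_lra|].
  right; exists q, (rmap q x); split; first by split; strip_lra.
  by rewrite rmap_comp //; apply: ple_intro; strip_lra.
Qed.

Hypotheses (fG : pfd G) (cG : seq_continuous G).

(** Otherwise go left, then up, as far as elements outside [K] persist: at the
    point [v] reached, the radical maps into [K] but [G v] does not. *)
Lemma radical_induction p (K : pm_obj G p -> Prop) : submod K ->
  (forall v, ple p v -> (forall x : pm_obj G v, radical x -> K (rmap p x)) ->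
     forall x : pm_obj G v, K (rmap p x)) ->
  forall z, K z.
Proof.
move=> sK hK z; apply: contrapT => nKz.
have h1 := px_py_le p; have h2 := px_py_ge p.
have [||q [qx qy]] := @pt_make _ a b (a - py p) (py p); [strip_lra|strip_lra|].
have pq : ple p q by apply: ple_intro; strip_lra.
have [|s [s0 s1 hs maxs]] :=
  @last_escaping_point _ _ _ _ G p q p K fG cG (ple_refl p) pq.
  by exists z; rewrite rmap_id.
have dx : 0 <= px p - px q by strip_lra.
have m1 := mulr_ge0 s0 dx.
have m2 : s * (px p - px q) <= px p - px q by apply: ler_piMl.
have [||v0 [v0x v0y]] := @pt_make _ a b (px p + s * (px q - px p)) (py p); [strip_lra|strip_lra|].
have [x0 nKx0] : exists x : pm_obj G v0, ~ K (rmap p x).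
  by apply: hs; rewrite ?v0x ?v0y ?qy; strip_lra.
have h3 := px_py_le v0; have h4 := px_py_ge v0.
have [||r [rx ry]] := @pt_make _ a b (px v0) (b - px v0); [strip_lra|strip_lra|].
have pv0 : ple p v0 by apply: ple_intro; strip_lra.
have v0r : ple v0 r by apply: ple_intro; strip_lra.
have [|t [t0 t1 ht maxt]] := @last_escaping_point _ _ _ _ G v0 r p K fG cG pv0 v0r.
  by exists x0.
have dy : 0 <= py r - py v0 by strip_lra.
have m3 := mulr_ge0 t0 dy.
have m4 : t * (py r - py v0) <= py r - py v0 by apply: ler_piMl.
have [||v [vx vy]] := @pt_make _ a b (px v0) (py v0 + t * (py r - py v0)); [strip_lra|strip_lra|].
have [x nKx] : exists x : pm_obj G v, ~ K (rmap p x).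
  by apply: ht; rewrite ?vx ?vy ?rx; strip_lra.
have pv : ple p v by apply: ple_intro; strip_lra.
have vE : px v = px p + s * (px q - px p) by rewrite vx.
have pxv : px v <= px p := ple_px pv.
have v0v : py v0 <= py v by strip_lra.
have pyv : py p <= py v := ple_py pv.
have ppx : a <= px p + py p := h2.
clear h2 h3 h4 m1 m2 m3 m4 s0 s1 t0 t1 dx dy v0x v0y pq v0r pv0.
apply/nKx/hK => // _ [z1 [z2 [r1 r2 ->]]]; rewrite rmapD; apply: submodD => //.
(* A point [w] left of [v] has a projection [w'] to the horizontal line through [p] that lies beyond
   the last escaping parameter; if the projection reaches l_0 or goes beyond it, the map is 0. *)
- case: r1 => [->|[w [y [[wy wx] ->]]]]; first by rewrite rmap0; exact: submod0.
  have vw : ple v w by apply: ple_intro; strip_lra.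
  rewrite rmap_comp //.
  have [le|gt] := leP (px w + py p) a.
    by rewrite rmap_bd //; [exact: submod0 | left].
  have [||w' [w'x w'y]] := @pt_make _ a b (px w) (py p); [strip_lra|strip_lra|].
  have pw' : ple p w' by apply: ple_intro; strip_lra.
  have w'w : ple w' w by apply: ple_intro; strip_lra.
  rewrite -(rmap_comp y pw' w'w); clear w'w pw' vw.
  have d0 : px p - px q != 0 by apply/eqP; strip_lra.
  apply: (maxs ((px p - px w) / (px p - px q))).
  + by rewrite ltr_pdivlMr; strip_lra.
  + by rewrite ler_pdivrMr; strip_lra.
  + have := divfK d0 (px p - px w); strip_lra.
  + by rewrite w'y qy subrr mulr0 addr0.
- case: r2 => [->|[w [y [[wx wy] ->]]]]; first by rewrite rmap0; exact: submod0.
  have vw : ple v w by apply: ple_intro; strip_lra.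
  have h5 := px_py_le w.
  rewrite rmap_comp //.
  have d0 : py r - py v0 != 0 by apply/eqP; strip_lra.
  apply: (maxt ((py w - py v0) / (py r - py v0))).
  + by rewrite ltr_pdivlMr; strip_lra.
  + by rewrite ler_pdivrMr; strip_lra.
  + by rewrite wx vx rx subrr mulr0 addr0.
  + have := divfK d0 (py w - py v0); strip_lra.
Qed.

Hypotheses (hG : exact_horizontal G) (eG : exact_vertical G).

(** In a linear relation the leading position is the rightmost one and, among
    several of those, the lowest. *)
Lemma leading_radical (I : eqType) (pos : I -> pt a b) (gen : forall i, pm_obj G (pos i))
    (s : seq I) (c : I -> F) p (i0 : I) :
  (forall i, i \in s -> supp (pos i) p) -> i0 \in s ->
  (forall j, j \in s -> px (pos j) < px (pos i0) \/
     px (pos j) = px (pos i0) /\ py (pos i0) <= py (pos j)) ->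
  \sum_(i <- s) c i *: rmap p (gen i) = 0 ->
  radical (\sum_(i <- s | pos i == pos i0) c i *: rmap (pos i0) (gen i)).
Proof.
set v := pos i0 => sup i0s lead rel.
have [pv pva pvb] := and3P (sup _ i0s); rewrite -/v in pv pva pvb.
have vx := ple_px pv; have vy := ple_py pv.
have g1 := px_py_le v; have g2 := px_py_ge v.
have g3 := px_py_le p; have g4 := px_py_ge p.
have [||q [qx qy]] := @pt_make _ a b (px v) (py p); [strip_lra|strip_lra|].
have [||p1 [p1x p1y]] := @pt_make _ a b (b - py v) (py p); [strip_lra|strip_lra|].
(* Terms strictly lower than the leading position [v] lie strictly to its left, since [v] is
   rightmost and lowest there. Being finitely many, they stay left of some m < px v. *)
pose low := [seq i <- s | py (pos i) < py v].
have [||m [m1 m2 m3]] := @seq_bound R I (fun i => px (pos i)) low (a - py p) (px v).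
- strip_lra.
- move=> i; rewrite mem_filter => /andP[h /lead[//|[_ ]]].
  by rewrite leNgt h.
have [||r [rx ry]] := @pt_make _ a b m (py p); [strip_lra|strip_lra|].
have pq : ple p q by apply: ple_intro; strip_lra.
have qv : ple q v by apply: ple_intro; strip_lra.
have qr : ple q r by apply: ple_intro; strip_lra.
have p1q : ple p1 q by apply: ple_intro; strip_lra.
(* [xi] collects the terms that can be formed at [v], [zeta] the lower ones, formed at [r]; the
   relation says that they cancel at [p]. *)
pose xi : pm_obj G v := \sum_(i <- s | ~~ (py (pos i) < py v)) c i *: rmap v (gen i).
pose zeta : pm_obj G r := \sum_(i <- s | py (pos i) < py v) c i *: rmap r (gen i).
have vi i : i \in s -> ~~ (py (pos i) < py v) -> ple v (pos i).
  by rewrite -leNgt => /lead h1 h2; apply: ple_intro => //; case: h1 => [/ltW //|[->]].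
have ri i : i \in s -> py (pos i) < py v -> ple r (pos i).
  move=> iS h; apply: ple_intro; first by rewrite rx m3 // mem_filter h iS.
  by rewrite ry; exact/ple_py/supp_ple/sup.
have E1 : rmap p (rmap q zeta + rmap q xi) = 0.
  transitivity (\sum_(i <- s) c i *: rmap p (gen i)); last exact: rel.
  rewrite rmapD (rmap_comp zeta pq qr) (rmap_comp xi pq qv).
  rewrite [RHS](bigID (fun i => py (pos i) < py v)) /=.
  congr (_ + _); rewrite ?/zeta ?/xi rmap_sum [LHS]big_seq_cond [RHS]big_seq_cond;
    apply: eq_bigr => i /andP[iS h]; rewrite rmapZ rmap_comp //.
  + exact: ple_trans pq qr.
  + exact: ri.
  + exact: vi.
(* An element of G(q) that dies at [p] comes from [gp], which is strictly above [v] because [p] lies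
   in the support of [v]. *)
have [||gp [gx gy]] := @pt_make _ a b (px v) (b - px p); [strip_lra|strip_lra|].
have [g hg] : exists g : pm_obj G gp, rmap q g = rmap q zeta + rmap q xi.
  by apply/(hG (p := q) (q := p) (r := gp)); rewrite ?gx ?gy //; strip_lra.
have vg : ple v gp by apply: ple_intro; strip_lra.
have E2 : rmap q zeta = rmap q (rmap v g - xi).
  by rewrite rmapB rmap_comp // hg addrK.
(* Every map from [v] to [p1] passes through l_1, because px p1 + py v = b. So [zeta] dies at [p1]
   and lifts vertically to the height of [v]. *)
have E3 : rmap p1 zeta = 0.
  rewrite -(rmap_comp zeta p1q qr) E2 rmap_comp //.
  by apply: rmap_bd => //; right; strip_lra.
have [||rp [rpx rpy]] := @pt_make _ a b m (py v); [strip_lra|strip_lra|].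
have [rho hrho] : exists rho : pm_obj G rp, rmap r rho = zeta.
  by apply/(hG (p := r) (q := p1) (r := rp)); rewrite ?rpx ?rpy //; strip_lra.
have vrp : ple v rp by apply: ple_intro; strip_lra.
have rrp : ple r rp by apply: ple_intro; strip_lra.
(* What is left dies at [q] and hence comes from the left of [v]. This exhibits [xi] as a
   combination of images from above and from the left. *)
have E4 : rmap q (rmap v g - xi - rmap v rho) = 0.
  by rewrite rmapB -E2 rmap_comp // -hrho rmap_comp // subrr.
have [||ap [ax ay]] := @pt_make _ a b (a - py p) (py v); [strip_lra|strip_lra|].
have [al hal] : exists al : pm_obj G ap, rmap v al = rmap v g - xi - rmap v rho.
  by apply/(eG (p := v) (q := q) (r := ap)); rewrite ?ax ?ay //; strip_lra.
have vap : ple v ap by apply: ple_intro; strip_lra.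
have sR := submod_radical v.
have Rxi : radical xi.
  have -> : xi = rmap v g - rmap v rho - rmap v al.
    by rewrite hal opprB addrA subrK opprB addrA addrAC subrr add0r.
  by repeat apply: submodB => //; apply: radical_rmap => //; [right|left|left]; strip_lra.
have -> : \sum_(i <- s | pos i == v) c i *: rmap v (gen i) = xi -
   \sum_(i <- s | ~~ (py (pos i) < py v) && (pos i != v)) c i *: rmap v (gen i).
  rewrite /xi [X in X - _](bigID (fun i => pos i == v)) /= addrK.
  by apply: eq_bigl => i; case: eqP => [->|]; rewrite ?andbF // ltxx.
apply: submodB => //; apply: submod_sum => // i iS /andP[h ne].
apply: submodZ => //; apply: radical_rmap; first exact: vi.
case: (lead _ iS) => [|[e1 e2]]; first by left.
right; rewrite lt_neqAle e2 andbT; apply: contraNneq ne => e.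
by apply/eqP; exact: pt_eq.
Qed.

End Radical.

(** A decomposition of [G] into blocks: [G u] has the basis [rmap u (gen i)],
    [i] ranging over the finite set [act u] of indices whose block contains [u]. *)
Record frame (R : realType) (a b : R) (F : fieldType) (G : pmod a b F) := Frame {
  ix : eqType;
  pos : ix -> pt a b;
  gen : forall i, pm_obj G (pos i);
  act : pt a b -> seq ix;
  crd : forall u, ix -> pm_obj G u -> F;
  act_uniq : forall u, uniq (act u);
  mem_act : forall u i, (i \in act u) = supp (pos i) u;
  crd_sum : forall u x, x = \sum_(i <- act u) crd i x *: rmap u (gen i);
  crd_gen : forall u c i, i \in act u ->
    crd i (\sum_(j <- act u) c j *: rmap u (gen j)) = c i;
  crd_out : forall u i (x : pm_obj G u), i \notin act u -> crd i x = 0 }.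

(** * Existence of block decompositions *)

Section FrameExistence.
Variables (R : realType) (a b : R) (F : fieldType) (G : pmod a b F).
Implicit Types u v w p : pt a b.

(** Bases of all G(v) modulo their radicals serve as generators. They are independent at p because
    the leading coefficients of a relation vanish, finite in number at p because independent lists
    in G(p) have bounded length, and spanning by [radical_induction]. *)
Lemma frame_exists : inJ G -> inhabited (frame G).
Proof.
move=> [fG [/cohomologicalE[vG hG eG] [cG _]]].
have basis v : {n : nat & {e : 'I_n -> pm_obj G v |
    (forall c : 'I_n -> F, radical (\sum_i c i *: e i) -> forall i, c i = 0) /\
    (forall x, exists c : 'I_n -> F, radical (x - \sum_i c i *: e i))}}.
  have [n hn] := cid (basis_mod (fG v) (submod_radical G v)).
  by have [e he] := cid hn; exists n, e.
pose I : eqType := {v : pt a b & 'I_(projT1 (basis v))}.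
pose pos (i : I) := tag i.
pose gen (i : I) : pm_obj G (pos i) := sval (projT2 (basis (tag i))) (tagged i).
have indep_mod (s : seq I) (c : I -> F) v : uniq s ->
    radical (\sum_(i <- s | pos i == v) c i *: rmap v (gen i)) ->
    forall i, i \in s -> pos i = v -> c i = 0.
  move=> us; pose T (k : 'I_(projT1 (basis v))) : I := Tagged _ k.
  have -> : \sum_(i <- s | pos i == v) c i *: rmap v (gen i) =
      \sum_k (if T k \in s then c (T k) else 0) *: sval (projT2 (basis v)) k.
    transitivity (\sum_(k | T k \in s) c (T k) *: rmap v (gen (T k))); last first.
      rewrite big_mkcond; apply: eq_bigr => k _.
      by case: ifP => _; rewrite ?scale0r // rmap_id.
    rewrite -big_filter -[RHS]big_filter.
    rewrite -(big_map T predT (fun i => c i *: rmap v (gen i))).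
    apply: perm_big; apply: uniq_perm; first exact: filter_uniq.
      rewrite map_inj_uniq; first by rewrite filter_uniq // index_enum_uniq.
      by move=> k l /eqP; rewrite eq_Tagged => /eqP.
    move=> [w k]; rewrite mem_filter; apply/andP/mapP.
      move=> [/eqP e js]; have {}e : w = v := e; subst w.
      by exists k => //; rewrite mem_filter js mem_index_enum.
    by move=> [l]; rewrite mem_filter => /andP[ls _] ->; split.
  move=> /(proj1 (proj2_sig (projT2 (basis v)))) h [w k] js e.
  by have {}e : w = v := e; subst w; have := h k; rewrite js.
have indep (s : seq I) (c : I -> F) p : uniq s ->
    (forall i, i \in s -> supp (pos i) p) ->
    \sum_(i <- s) c i *: rmap p (gen i) = 0 -> forall i, i \in s -> c i = 0.
  move=> us sup rel i iS; apply/eqP; apply: contraT => ci.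
  (* Zero coefficients are discarded, so that the leading one is nonzero and [indep_mod] contradicts
     it. *)
  pose t := [seq j <- s | c j != 0].
  have [|i0 i0t lead] := @lex_max R I (fun j => px (pos j)) (fun j => py (pos j)) t i.
    by rewrite mem_filter ci.
  have := i0t; rewrite mem_filter => /andP[/eqP ci0 i0s].
  case: ci0; apply: (indep_mod t c (pos i0)) => //; first exact: filter_uniq.
  apply: (@leading_radical _ _ _ _ G vG hG eG I pos gen t c p i0) => //.
    by move=> j; rewrite mem_filter => /andP[_]; exact: sup.
  rewrite big_filter -[RHS]rel [RHS](bigID (fun j => c j != 0)) /=.
  rewrite [X in _ + X]big1 ?addr0 // => j; rewrite negbK => /eqP ->.
  by rewrite scale0r.
have finite p : {s : seq I | uniq s & forall i, (i \in s) = supp (pos i) p}.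
  apply: cid2; have [N hN] := indep_bound (fG p).
  pose good (s : seq I) := uniq s /\ forall i, i \in s -> supp (pos i) p.
  have goodN s : good s -> (size s <= N)%N.
    move=> [us sup]; case E: s => [//|i0 s']; rewrite -E.
    apply: (hN (size s) (fun k => rmap p (gen (nth i0 s k)))) => c rel k.
    (* The coefficients, indexed by positions in the list, are extended by 0 to all indices. *)
    have := @indep s (fun i => oapp c 0 (insub (index i s))) p us sup _ (nth i0 s k).
    rewrite mem_nth // index_uniq // valK /=; apply=> //.
    rewrite (big_nth i0) big_mkord -[RHS]rel; apply: eq_bigr => l _.
    by rewrite index_uniq // valK.
  pose Q n := `[< exists s, good s /\ size s = n >].
  have exQ : exists n, Q n by exists 0%N; apply/asboolP; exists [::].
  have bQ n : Q n -> (n <= N)%N by move=> /asboolP[s [gs <-]]; exact: goodN.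
  case: (ex_maxnP exQ bQ) => n /asboolP[s [[us sup] sn]] mx.
  exists s => // i; apply/idP/idP; first exact: sup.
  move=> si; apply: contraT => iNs.
  have : (n.+1 <= n)%N; last by rewrite ltnn.
  apply: mx; apply/asboolP; exists (i :: s); split; last by rewrite /= sn.
  split; first by rewrite /= iNs.
  by move=> j; rewrite in_cons => /orP[/eqP ->|/sup].
pose act p := s2val (finite p).
have act_uniq p : uniq (act p) := s2valP (finite p).
have mem_act p i : (i \in act p) = supp (pos i) p := s2valP' (finite p) i.
have span p z : exists c : I -> F, z = \sum_(i <- act p) c i *: rmap p (gen i).
  pose K (z : pm_obj G p) := exists c : I -> F, z = \sum_(i <- act p) c i *: rmap p (gen i).
  have sK : submod K.
    split; first by exists (fun=> 0); rewrite big1 // => i _; rewrite scale0r.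
    move=> k _ _ [c ->] [d ->]; exists (fun i => k * c i + d i).
    by rewrite scaler_sumr -big_split; apply: eq_bigr => i _; rewrite scalerDl scalerA.
  apply: (radical_induction vG fG cG sK) => v pv hv x.
  have [c hc] := proj2 (proj2_sig (projT2 (basis v))) x.
  rewrite -[x](subrK (\sum_i c i *: sval (projT2 (basis v)) i)) rmapD.
  apply: submodD => //; first exact: hv.
  rewrite rmap_sum; apply: submod_sum => // k _ _; rewrite rmapZ; apply: submodZ => //.
  pose i : I := existT (fun v => 'I_(projT1 (basis v))) v k.
  have [si|nsi] := boolP (supp v p); last first.
    by rewrite rmap_unsupp //; exact: submod0.
  exists (fun j => (j == i)%:R).
  rewrite (bigD1_seq i) ?mem_act //= eqxx scale1r big1 ?addr0 // => j /negbTE ->.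
  by rewrite scale0r.
have [crd0 hcrd0] := @choice _ _ (fun z : {p : pt a b & pm_obj G p} => fun c : I -> F =>
    tagged z = \sum_(i <- act (tag z)) c i *: rmap (tag z) (gen i)) (fun z => span _ _).
(* Coordinates are set to 0 outside [act u], where the chosen coefficients are arbitrary. *)
pose crd u i (x : pm_obj G u) := if i \in act u then crd0 (existT _ u x) i else 0.
have crdE u x : x = \sum_(i <- act u) crd u i x *: rmap u (gen i).
  rewrite {1}[x](hcrd0 (existT _ u x)) big_seq [RHS]big_seq.
  by apply: eq_bigr => i; rewrite /crd => ->.
constructor; exists I pos gen act crd => //.
- move=> u c i iu; apply/eqP; rewrite -subr_eq0; apply/eqP.
  apply: (@indep (act u)
    (fun j => crd u j (\sum_(j <- act u) c j *: rmap u (gen j)) - c j) u) => //.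
    by move=> j; rewrite mem_act.
  under eq_bigr => j _ do rewrite scalerBl.
  by rewrite sumrB -crdE subrr.
- by move=> u i x /negbTE h; rewrite /crd h.
Qed.

End FrameExistence.

(** * Coordinates in a block decomposition *)

Section FrameTheory.
Variables (R : realType) (a b : R) (F : fieldType) (G : pmod a b F).
Variable (B : frame G).
Implicit Types u v w p : pt a b.

Lemma crd_linear u (i : ix B) c (x y : pm_obj G u) :
  crd i (c *: x + y) = c * crd i x + crd i y.
Proof.
have [iu|nu] := boolP (i \in act B u); last by rewrite !crd_out // mulr0 addr0.
rewrite -[RHS](crd_gen (fun j => c * crd j x + crd j y) iu); congr (crd _ _).
under eq_bigr => j _ do rewrite scalerDl -scalerA.
by rewrite big_split /= -scaler_sumr -!crd_sum.
Qed.

Lemma crd0 u (i : ix B) : crd i (0 : pm_obj G u) = 0.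
Proof. by rewrite -[X in crd i X](addNr 0) -scaleN1r crd_linear mulN1r addNr. Qed.

Lemma crdZ u (i : ix B) c (x : pm_obj G u) : crd i (c *: x) = c * crd i x.
Proof. by rewrite -[c *: x]addr0 crd_linear crd0 addr0. Qed.

(** Indices active only at [v] map to 0 at [u], and indices active only at [u] have coefficient 0 by
    hypothesis. *)
Lemma act_sum_rmap (X : pmod a b F) u v (xs : forall i : ix B, pm_obj X (pos i))
    (c : ix B -> F) : vanishes_on_bd X -> ple u v ->
  (forall i, i \in act B u -> i \notin act B v -> c i = 0) ->
  rmap u (\sum_(i <- act B v) c i *: rmap v (xs i)) =
  \sum_(i <- act B u) c i *: rmap u (xs i).
Proof.
move=> vX uv hc; rewrite rmap_sum.
rewrite (bigID (fun j => j \in act B u)) /= [X in _ + X]big1_seq ?addr0; last first.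
  move=> j /andP[ju jv]; rewrite rmapZ rmap_comp //; last first.
    by move: jv; rewrite mem_act; exact: supp_ple.
  by rewrite rmap_unsupp ?scaler0 // -mem_act.
rewrite [RHS](bigID (fun j => j \in act B v)) /= [X in _ = _ + X]big1_seq ?addr0; last first.
  by move=> j /andP[jv ju]; rewrite hc // scale0r.
rewrite -big_filter -[RHS]big_filter.
rewrite (perm_big [seq j <- act B u | j \in act B v]) /=; last first.
  apply: uniq_perm; rewrite ?filter_uniq ?act_uniq // => j.
  by rewrite !mem_filter andbC.
rewrite big_seq [RHS]big_seq; apply: eq_bigr => j.
rewrite mem_filter => /andP[jv ju]; rewrite rmapZ rmap_comp //.
by move: jv; rewrite mem_act; exact: supp_ple.
Qed.

Lemma crd_rmap u v (i : ix B) (x : pm_obj G v) : vanishes_on_bd G ->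
  ple u v -> i \in act B u -> crd i (rmap u x) = crd i x.
Proof.
move=> vG uv iu; rewrite [X in rmap u X](crd_sum B x) act_sum_rmap ?crd_gen //.
by move=> j _; exact: crd_out.
Qed.

Lemma frame_eq u (x y : pm_obj G u) :
  (forall i, i \in act B u -> crd (f := B) i x = crd i y) -> x = y.
Proof.
move=> h; rewrite (crd_sum B x) [RHS](crd_sum B y) big_seq [RHS]big_seq.
by apply: eq_bigr => i /h ->.
Qed.

End FrameTheory.

(** * Projectivity and injectivity of blocks *)

Section FrameMaps.
Variables (R : realType) (a b : R) (F : fieldType) (G : pmod a b F).
Variable (B : frame G).
Implicit Types u v w p : pt a b.

(** The Yoneda lemma for blocks: the images of the generators can be prescribed freely, because [X]
    vanishes on the boundary and so respects the support of every block. *)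
Lemma frame_map (X : pmod a b F) (xs : forall i : ix B, pm_obj X (pos i)) :
  vanishes_on_bd G -> vanishes_on_bd X ->
  exists g : pmor G X, forall u x,
    pmor_fun g u x = \sum_(i <- act B u) crd i x *: rmap u (xs i).
Proof.
move=> vG vX; apply: pmor_make => [u k x y|u v x uv].
  rewrite scaler_sumr -big_split; apply: eq_bigr => i _.
  by rewrite crd_linear scalerDl scalerA.
rewrite act_sum_rmap // => [|i _]; last exact: crd_out.
by rewrite big_seq [RHS]big_seq; apply: eq_bigr => i iu; rewrite crd_rmap.
Qed.

Lemma frame_projective (X Y : pmod a b F) (e : pmor X Y) (f : pmor G Y) :
  vanishes_on_bd G -> vanishes_on_bd X ->
  (forall u y, exists x, pmor_fun e u x = y) ->
  exists g : pmor G X, forall u x, pmor_fun e u (pmor_fun g u x) = pmor_fun f u x.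
Proof.
move=> vG vX se.
pose xs (i : ix B) := sval (cid (se _ (pmor_fun f _ (gen i)))).
have xsE (i : ix B) : pmor_fun e _ (xs i) = pmor_fun f _ (gen i).
  exact: (proj2_sig (cid (se _ (pmor_fun f _ (gen i))))).
have [g hg] := frame_map xs vG vX; exists g => u x.
rewrite hg linear_sum [in RHS](crd_sum B x) linear_sum; apply: eq_bigr => i _.
by rewrite !linearZ /= !pmor_rmap xsE.
Qed.

(** Dually, a map into [G] is a family of functionals, one for each block and natural on its
    support; at every point only finitely many blocks contribute. *)
Lemma frame_comap (Y : pmod a b F) (al : forall u, ix B -> pm_obj Y u -> F) :
  vanishes_on_bd G ->
  (forall u i c x y, al u i (c *: x + y) = c * al u i x + al u i y) ->
  (forall u v i (y : pm_obj Y v), ple u v -> i \in act B u ->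
     al u i (rmap u y) = al v i y) ->
  (forall u i y, i \notin act B u -> al u i y = 0) ->
  exists g : pmor Y G, forall u y i, i \in act B u ->
    crd i (pmor_fun g u y) = al u i y.
Proof.
move=> vG lal nal oal.
have [||g hg] := @pmor_make _ a b F Y G
  (fun u y => \sum_(i <- act B u) al u i y *: rmap u (gen i)).
- move=> u k x y; rewrite scaler_sumr -big_split; apply: eq_bigr => i _.
  by rewrite lal scalerDl scalerA.
- move=> u v y uv; rewrite act_sum_rmap // => [|i _]; last exact: oal.
  by rewrite big_seq [RHS]big_seq; apply: eq_bigr => i iu; rewrite nal.
by exists g => u y i iu; rewrite hg (crd_gen (fun i => al u i y)).
Qed.

End FrameMaps.

(** * Extension of maps into blocks; retracts *)

Section BlockFunctionals.
Variables (R : realType) (a b : R) (F : fieldType).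
Implicit Types (u v w p : pt a b) (X Y G : pmod a b F).

(** Natural transformations from [X] to the block with top element [n]. *)
Definition block_functional X n (f : forall u, pm_obj X u -> F) :=
  [/\ forall u c x y, f u (c *: x + y) = c * f u x + f u y,
      forall u v (x : pm_obj X v), ple u v -> supp n u -> f u (rmap u x) = f v x
    & forall u x, ~~ supp n u -> f u x = 0].

Lemma supp_sequence n u0 : supp n u0 -> exists p : nat -> pt a b,
  [/\ forall k, supp n (p k), forall k, ple (p k.+1) (p k),
      forall u, supp n u -> exists k, ple (p k) u
    & forall v, ~~ ple v n -> exists k,
        px v + py (p k) <= a \/ b <= px (p k) + py v].
Proof.
case/and3P => un ua ub.
have ux := ple_px un; have uy := ple_py un.
(* Both side lengths of the support bound [e0], so that already p_0 lies in it. *)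
pose e0 := Num.min (b - px n - py n) (px n + py n - a).
have e0p : 0 < e0 by rewrite lt_min; apply/andP; split; lra.
have e1 : e0 <= b - px n - py n by rewrite ge_min lexx.
have e2 : e0 <= px n + py n - a by rewrite ge_min lexx orbT.
pose e (k : nat) : R := e0 / k.+1%:R.
have ep k : 0 < e k by rewrite divr_gt0.
have el k : e k <= e0 by rewrite ler_pdivrMr // ler_peMr ?(ltW e0p) // ler1n.
have eS k : e k.+1 <= e k by rewrite ler_pM2l // lef_pV2 ?posrE // ler_nat.
have eN d : 0 < d -> exists k, e k <= d.
  move=> d0; exists (Num.bound (e0 / d)).
  have := archi_boundP (ltW (divr_gt0 e0p d0)); rewrite ltr_pdivrMr // => h.
  rewrite ler_pdivrMr // mulrC; apply: le_trans (ltW h) _.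
  by rewrite ler_pM2r // ler_nat.
have pex k : {w : pt a b | px w = b - py n - e k /\ py w = a - px n + e k}.
  have := ep k; have := el k => h1 h2.
  have := px_py_ge n; have := px_py_le n => h3 h4.
  by apply: pt_make; lra.
pose p k := sval (pex k).
have ppx k : px (p k) = b - py n - e k by case: (proj2_sig (pex k)).
have ppy k : py (p k) = a - px n + e k by case: (proj2_sig (pex k)).
exists p; split.
- move=> k; have h1 := el k; have h2 := ep k; apply/and3P; split.
  + by apply: ple_intro; rewrite ?ppx ?ppy; lra.
  + by rewrite ppy; lra.
  + by rewrite ppx; lra.
- by move=> k; have h := eS k; apply: ple_intro; rewrite !(ppx, ppy); lra.
- move=> u /and3P[_ u1 u2].
  have [|k hk] := eN (Num.min (px n + py u - a) (b - px u - py n)).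
    by rewrite lt_min; apply/andP; split; lra.
  move: hk; rewrite le_min => /andP[h1 h2].
  by exists k; apply: ple_intro; rewrite ?ppx ?ppy; lra.
- move=> v; rewrite pleE negb_and -!ltNge => /orP[h|h].
  + have [|k hk] := eN (px n - px v); first lra.
    by exists k; left; rewrite ppy; lra.
  + have [|k hk] := eN (py v - py n); first lra.
    by exists k; right; rewrite ppx; lra.
Qed.

(** The colimit of the Y(p_k) is never formed. [r k] prescribes values on the elements of Y(p_k)
    that enter X further along the sequence, and functionals on the finite-dimensional Y(p_k) are
    extended one index at a time. *)
Lemma block_functional_extend X Y n (m : pmor X Y) (f : forall u, pm_obj X u -> F) :
  pfd Y -> vanishes_on_bd Y -> (forall u, injective (pmor_fun m u)) ->
  block_functional n f ->
  exists g : forall u, pm_obj Y u -> F,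
    block_functional n g /\ forall u x, supp n u -> g u (pmor_fun m u x) = f u x.
Proof.
move=> fY vY im [lf nf of_].
have [[u0 su0]|nsu] := pselect (exists u0, supp n u0); last first.
  exists (fun _ _ => 0); split; last by move=> u x su; case: nsu; exists u.
  by split=> // u c x y; rewrite mulr0 addr0.
have [p [sp pS pcof pout]] := supp_sequence su0.
have pmono j k : (j <= k)%N -> ple (p k) (p j).
  move=> /subnK <-; elim: (k - j)%N => [|i IH]; first exact: ple_refl.
  by rewrite addSn; exact: ple_trans (pS _) IH.
pose r k (y : pm_obj Y (p k)) (c : F) := exists j (x : pm_obj X (p j)),
  [/\ (k <= j)%N, rmap (p j) y = pmor_fun m _ x & c = f _ x].
have rup k y c : r k y c -> exists i, forall l, (i <= l)%N ->
    exists x : pm_obj X (p l), rmap (p l) y = pmor_fun m _ x /\ c = f _ x.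
  move=> [i [x [ki yx ->]]]; exists i => l il; exists (rmap (p l) x).
  by rewrite pmor_rmap -yx rmap_comp ?nf //; exact: pmono.
have r0 k : r k 0 0.
  exists k, 0; split; rewrite ?rmap0 ?linear0 //.
  by have := lf (p k) (-1) 0 0; rewrite scaler0 addr0 mulN1r addNr.
have rD k l x c y d : r k x c -> r k y d -> r k (l *: x + y) (l * c + d).
  move=> /rup[i hx] /rup[j hy]; pose n' := maxn k (maxn i j).
  have iN : (i <= n')%N by rewrite !leq_max leqnn orbT.
  have jN : (j <= n')%N by rewrite !leq_max leqnn !orbT.
  have [x' [ex ->]] := hx _ iN; have [y' [ey ->]] := hy _ jN.
  exists n', (l *: x' + y'); split; first exact: leq_maxl.
  - by rewrite rmapD rmapZ ex ey linearP.
  - by rewrite lf.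
have rf k c : r k 0 c -> c = 0.
  move=> [j [x [_ + ->]]]; rewrite rmap0 => /esym/eqP.
  rewrite -[0](linear0 (pmor_fun m (p j))) (inj_eq (im _)) => /eqP ->.
  by have := lf (p j) (-1) 0 0; rewrite scaler0 addr0 mulN1r addNr.
pose ext k (g : {linear pm_obj Y (p k) -> F^o}) := forall y c, r k y c -> g y = c.
have ext0 : {g : {linear pm_obj Y (p 0%N) -> F^o} | ext 0%N g}.
  exact/cid/(functional_extension (fY _) (r0 0%N) (rD 0%N) (rf 0%N)).
have extS k (s : {g | ext k g}) : {g : {linear pm_obj Y (p k.+1) -> F^o} | ext k.+1 g &
    forall y, g (rmap _ y) = sval s y}.
  apply: cid2; case: s => g hg /=.
  (* The next functional is prescribed on sums of an image of Y(p_k) and an element governed by [r].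
     If such a sum is 0, then -y is itself governed by [r k], so the two prescriptions agree. *)
  pose r' z c := exists y d c', [/\ z = rmap (p k.+1) y + d, r k.+1 d c' & c = g y + c'].
  have [|||g' hg'] := @functional_extension F (pm_obj Y (p k.+1)) r' (fY _).
  - by exists 0, 0, 0; split; rewrite ?rmap0 ?linear0 ?addr0.
  - move=> l _ _ _ _ [x [d [c [-> rd ->]]]] [y [e [c' [-> re ->]]]].
    exists (l *: x + y), (l *: d + e), (l * c + c'); split; first 1 last.
    + exact: rD.
    + by rewrite linearP mulrDr addrACA.
    + by rewrite rmapD rmapZ scalerDr addrACA.
  - move=> c [y [d [c' [/esym/eqP]]]]; rewrite addrC addr_eq0 => /eqP -> [j [x [kj h ->]]] ->.
    have -> : f _ x = - g y; last by rewrite subrr.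
    rewrite -linearN; apply/esym/hg; exists j, x; split=> //; first exact: ltnW.
    rewrite -h -scaleN1r rmapZ -[in RHS]scaleN1r rmapZ rmap_comp ?scaleN1r //.
    exact: pmono.
  - exists g'.
    + by move=> y c rc; apply: hg'; exists 0, y, c; rewrite rmap0 linear0 !add0r.
    + by move=> y; apply: hg'; exists y, 0, 0; rewrite !addr0.
pose gs := nat_rect (fun k => {g | ext k g}) ext0
  (fun k s => exist _ (s2val (extS k s)) (s2valP (extS k s))).
have gsS k y : sval (gs k.+1) (rmap _ y) = sval (gs k) y by exact: (s2valP' (extS k (gs k))).
have gsle j k y : (j <= k)%N -> sval (gs k) (rmap _ y) = sval (gs j) y.
  elim: k => [|k IH]; first by case: j y => // y _; rewrite rmap_id.
  rewrite leq_eqVlt => /orP[/eqP e|]; first by subst j; rewrite rmap_id.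
  move=> jk; rewrite -[RHS]IH // -[RHS]gsS rmap_comp //; exact: pmono.
have pcof' u : exists k, supp n u -> ple (p k) u.
  by have [/pcof[k hk]|_] := boolP (supp n u); [exists k | exists 0%N].
have [kk kkP] := choice pcof'.
pose g u (y : pm_obj Y u) : F :=
  if supp n u then sval (gs (kk u)) (rmap _ y) else 0.
have gE u (y : pm_obj Y u) k : supp n u -> ple (p k) u -> g u y = sval (gs k) (rmap _ y).
  rewrite /g => su pk; rewrite su.
  set j := kk u; rewrite -(gsle k (maxn k j)) ?leq_maxl // -(gsle j (maxn k j)) ?leq_maxr //.
  rewrite !rmap_comp //; first 1 last.
  - by apply: pmono; exact: leq_maxr.
  - exact: kkP.
  - by apply: pmono; exact: leq_maxl.
have gout u (y : pm_obj Y u) : ~~ supp n u -> g u y = 0 by rewrite /g => /negbTE ->.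
exists g; split; first split=> //.
- move=> u c x y; have [su|nsu] := boolP (supp n u); last by rewrite !gout // mulr0 addr0.
  by have [k hk] := pcof u su; rewrite !(gE _ _ k) // rmapD rmapZ linearP.
- move=> u v x uv su; have [k hk] := pcof u su.
  rewrite (gE _ _ k) // rmap_comp //.
  have [sv|nsv] := boolP (supp n v).
    by rewrite (gE _ _ k) //; exact: ple_trans uv.
  rewrite (gout _ _ nsv).
  (* If [v] were below [n], it would inherit the support condition from [u]. So it is not, and the
     map from [v] to a late p_k is 0. *)
  have [|j hj] := pout v.
    apply: contra nsv => vn; case/and3P: su => un ua ub; apply/and3P; split=> //.
    + by have := ple_py uv; lra.
    + by have := ple_px uv; lra.
  rewrite -(gsle k (maxn k j)) ?leq_maxl //.
  have h1 : ple (p (maxn k j)) (p k) by apply: pmono; exact: leq_maxl.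
  have h2 := pmono _ _ (leq_maxr k j).
  rewrite rmap_comp //; last exact: ple_trans uv.
  rewrite rmap_bd ?linear0 //.
  by have := ple_px h2; have := ple_py h2; case: hj; [left|right]; lra.
- move=> u x su; have [k hk] := pcof u su; rewrite (gE _ _ k) //.
  apply: (proj2_sig (gs k)); exists k, (rmap (p k) x); split=> //.
    by rewrite rmap_id pmor_rmap.
  by rewrite nf.
Qed.

Lemma frame_injective X Y G (B : frame G) (m : pmor X Y) (f : pmor X G) :
  vanishes_on_bd G -> pfd Y -> vanishes_on_bd Y -> (forall u, injective (pmor_fun m u)) ->
  exists g : pmor Y G, forall u x, pmor_fun g u (pmor_fun m u x) = pmor_fun f u x.
Proof.
move=> vG fY vY im.
have ext (i : ix B) : {g : forall u, pm_obj Y u -> F | block_functional (pos i) g &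
    forall u x, supp (pos i) u -> g u (pmor_fun m u x) = crd i (pmor_fun f u x)}.
  apply: cid2; have [|g [h1 h2]] := @block_functional_extend X Y (pos i) m
    (fun u x => crd i (pmor_fun f u x)) fY vY im; last by exists g.
  split=> [u c x y|u v x uv su|u x su].
  - by rewrite linearP crd_linear.
  - by rewrite pmor_rmap crd_rmap // mem_act.
  - by rewrite crd_out // mem_act.
pose al u (i : ix B) := s2val (ext i) u.
have [|||g hg] := @frame_comap _ _ _ _ _ B Y al vG.
- by move=> u i; case: (s2valP (ext i)) => h _ _; exact: h.
- by move=> u v i y uv; rewrite mem_act; case: (s2valP (ext i)) => _ h _; exact: h.
- by move=> u i y; rewrite mem_act; case: (s2valP (ext i)) => _ _; exact.
exists g => u x; apply: (frame_eq (B := B)) => i iu.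
by rewrite hg // /al (s2valP' (ext i)) // -mem_act.
Qed.

(** This will put projectives and injectives into J: a projective is a retract of its cover, an
    injective of the object of J into which it embeds. *)
Lemma retract_inJ G X (i : pmor X G) (r : pmor G X) :
  (forall u x, pmor_fun r u (pmor_fun i u x) = x) -> inJ G -> inJ X.
Proof.
move=> ri [fG [[vG eG] [cG [w bG]]]].
have ex p q s : exact_at (@rmap _ a b F G p s) (@rmap _ a b F G q p) ->
    exact_at (@rmap _ a b F X p s) (@rmap _ a b F X q p).
  move=> e y; split=> [y0|[x <-]].
  - have [|z hz] := (e (pmor_fun i p y)).1; first by rewrite -pmor_rmap y0 linear0.
    by exists (pmor_fun r s z); rewrite -pmor_rmap hz ri.
  - have h : rmap q (rmap p (pmor_fun i s x)) = 0 by apply/e; exists (pmor_fun i s x).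
    by have := congr1 (pmor_fun r q) h; rewrite !pmor_rmap ri linear0.
split.
  move=> u; have [n [e he]] := fG u; exists n, (fun k => pmor_fun r u (e k)) => x.
  have [c hc] := he (pmor_fun i u x); exists c.
  by rewrite -[LHS]ri hc linear_sum; apply: eq_bigr => k _; rewrite linearZ.
split; first split.
- by move=> u hu x; rewrite -[x]ri (vG u hu (pmor_fun i u x)) linear0.
- move=> u v t h1 h2 h3 h4 h5 k; have [e1 [e2 e3]] := eG u v t h1 h2 h3 h4 h5 k.
  by split; [exact: ex | split; exact: ex].
split.
- move=> us u incr cv; have [h1 h2] := cG us u incr cv; split.
  + move=> x hx; rewrite -[x]ri (h1 (pmor_fun i u x)) ?linear0 // => k.
    by rewrite -pmor_rmap hx linear0.
  + move=> xs hxs; have [k|z hz] := h2 (fun k => pmor_fun i _ (xs k)).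
      by rewrite -pmor_rmap hxs.
    by exists (pmor_fun r u z) => k; rewrite -pmor_rmap hz ri.
- by exists w => u uw x; rewrite -[x]ri (bG u uw (pmor_fun i u x)) linear0.
Qed.

End BlockFunctionals.

(** * Subquotients and bifiltered spaces *)

Section Subquotient.
Variables (F : fieldType) (V : lmodType F) (P N : V -> Prop).

(** The representative is chosen from the coset as a set, so it depends only on the class, and
    elements of the quotient can be kept as vectors of [V]. *)
Definition canonical_rep (x : V) : V := xget 0 [set y | P y /\ N (x - y)]%classic.

(** The quotient of [P] by [P] meet [N], realised by canonical representatives. *)
Definition subquot of submod P & submod N : Type :=
  {x : V | `[< P x /\ canonical_rep x = x >]}.

Variables (hP : submod P) (hN : submod N).
Local Notation Q := (subquot hP hN).

HB.instance Definition _ := Choice.copy Q {x : V | `[< P x /\ canonical_rep x = x >]}.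

Lemma canonical_repP x : P x -> P (canonical_rep x) /\ N (x - canonical_rep x).
Proof.
move=> px; have : exists y, P y /\ N (x - y).
  by exists x; rewrite subrr; split=> //; exact: submod0.
by move=> /(@xgetPex _ 0 [set y | P y /\ N (x - y)]%classic).
Qed.

Lemma canonical_rep_eq x y : N (x - y) -> canonical_rep x = canonical_rep y.
Proof.
move=> nxy; congr xget; apply/seteqP; split=> z /= [pz nz]; split=> //.
- by rewrite -(subrK x y) -addrA; apply: submodD => //; rewrite -opprB; exact: submodN.
- by rewrite -(subrK y x) -addrA; apply: submodD.
Qed.

(** Arguments outside [P] are sent to the class of 0, which makes [cls] total. *)
Definition class_rep x := canonical_rep (if `[< P x >] then x else 0).

Lemma class_rep_proof x :
  `[< P (class_rep x) /\ canonical_rep (class_rep x) = class_rep x >].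
Proof.
rewrite /class_rep; set y := if _ then _ else _; have py : P y.
  by rewrite /y; case: asboolP => // _; exact: submod0.
have [pr nyr] := canonical_repP py; apply/asboolP; split=> //.
by apply: canonical_rep_eq; rewrite -opprB; exact: submodN.
Qed.

Definition cls x : Q := exist (fun x => `[< P x /\ canonical_rep x = x >]) _ (class_rep_proof x).
Definition repr (q : Q) : V := sval q.

Lemma repr_in q : P (repr q).
Proof. by case: q => x /= /asboolP[]. Qed.

Lemma repr_cls x : P x -> N (x - repr (cls x)).
Proof.
by move=> px; rewrite /repr /= /class_rep; case: asboolP => // _; case: (canonical_repP px).
Qed.

Lemma clsK q : cls (repr q) = q.
Proof.
apply: val_inj; rewrite /= /class_rep; case: asboolP => [_|/(_ (repr_in q))//].
by case: q => x /= /asboolP[].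
Qed.

Lemma cls_eq x y : P x -> P y -> N (x - y) -> cls x = cls y.
Proof.
move=> px py nxy; apply: val_inj; rewrite /= /class_rep.
by do 2!case: asboolP => // _; exact: canonical_rep_eq.
Qed.

Lemma cls_inj x y : P x -> P y -> cls x = cls y -> N (x - y).
Proof.
move=> px py e.
have -> : x - y = (x - repr (cls x)) - (y - repr (cls y)) by rewrite e opprB addrA subrK.
by apply: submodB => //; exact: repr_cls.
Qed.

Let add q r := cls (repr q + repr r).
Let opp q := cls (- repr q).
Let scale c q := cls (c *: repr q).

Lemma repr_add x y : P x -> P y -> cls (repr (cls x) + repr (cls y)) = cls (x + y).
Proof.
move=> px py; apply: cls_eq; try by apply: submodD => //; exact: repr_in.
rewrite -opprB; apply: submodN => //; rewrite opprD addrACA.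
by apply: submodD => //; exact: repr_cls.
Qed.

Lemma subquot_addA : associative add.
Proof.
move=> q r s; rewrite /add -{1}(clsK q) -{2}(clsK s) !repr_add ?addrA //;
  by [exact: repr_in | apply: submodD => //; exact: repr_in].
Qed.

Lemma subquot_addC : commutative add.
Proof. by move=> q r; rewrite /add addrC. Qed.

Lemma subquot_add0 : left_id (cls 0) add.
Proof.
move=> q; rewrite /add -{1}(clsK q) repr_add ?add0r ?clsK //; last exact: repr_in.
exact: submod0.
Qed.

Lemma subquot_addN : left_inverse (cls 0) opp add.
Proof.
move=> q; rewrite /add /opp -{2}(clsK q) repr_add ?addNr //; last exact: repr_in.
by apply: submodN => //; exact: repr_in.
Qed.

HB.instance Definition _ := GRing.isZmodule.Build Q
  subquot_addA subquot_addC subquot_add0 subquot_addN.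

Lemma clsD x y : P x -> P y -> cls (x + y) = cls x + cls y.
Proof. by move=> px py; rewrite -repr_add. Qed.

Lemma repr_scale c x : P x -> cls (c *: repr (cls x)) = cls (c *: x).
Proof.
move=> px; apply: cls_eq; try by apply: submodZ => //; exact: repr_in.
rewrite -opprB -scalerBr; apply: submodN => //; apply: submodZ => //.
exact: repr_cls.
Qed.

Lemma subquot_scaleA c d q : scale c (scale d q) = scale (c * d) q.
Proof.
by rewrite /scale repr_scale ?scalerA //; apply: submodZ => //; exact: repr_in.
Qed.

Lemma subquot_scale1 : left_id 1 scale.
Proof. by move=> q; rewrite /scale scale1r clsK. Qed.

Lemma subquot_scaleDr : right_distributive scale +%R.
Proof.
move=> c q r; rewrite /scale -clsD; try by apply: submodZ => //; exact: repr_in.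
rewrite -scalerDr -{1}(clsK q) -{1}(clsK r) -clsD ?repr_scale //;
  by [exact: repr_in | apply: submodD => //; exact: repr_in].
Qed.

Lemma subquot_scaleDl q : {morph scale^~ q : c d / c + d}.
Proof.
by move=> c d; rewrite /scale scalerDl clsD //; apply: submodZ => //; exact: repr_in.
Qed.

HB.instance Definition _ := GRing.Zmodule_isLmodule.Build F Q
  subquot_scaleA subquot_scale1 subquot_scaleDr subquot_scaleDl.

Lemma cls_linear c x y : P x -> P y -> cls (c *: x + y) = c *: cls x + cls y.
Proof.
move=> px py; rewrite clsD //; last exact: submodZ.
by congr (_ + _); rewrite -(repr_scale c px).
Qed.

Lemma cls_eq0 x : P x -> (cls x = 0 <-> N x).
Proof.
move=> px; have p0 := submod0 hP; split=> [e|nx].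
  by rewrite -[x]subr0; exact: cls_inj.
by apply: cls_eq; rewrite ?subr0.
Qed.

Lemma cls_ind (K : Q -> Prop) : (forall x, P x -> K (cls x)) -> forall q, K q.
Proof. by move=> h q; rewrite -(clsK q); apply/h/repr_in. Qed.

(** Linearity of [g] is asked on [P] only, because evaluation by [fsum] is controlled only for
    finite support. *)
Lemma subquot_lift (W : lmodType F) (g : V -> W) :
  (forall c x y, P x -> P y -> g (c *: x + y) = c *: g x + g y) ->
  (forall x, P x -> N x -> g x = 0) ->
  (forall x, P x -> g (repr (cls x)) = g x) /\ linear (fun q => g (repr q)).
Proof.
move=> lg kg; have key x : P x -> g (repr (cls x)) = g x.
  move=> px; apply/eqP; rewrite -subr_eq0; apply/eqP.
  have pr := repr_in (cls x).
  have pN : P (- x + repr (cls x)) by apply: submodD => //; exact: submodN.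
  have := lg (-1) x (repr (cls x)) px pr; rewrite !scaleN1r kg //; last first.
    by rewrite addrC -opprB; apply: submodN => //; exact: repr_cls.
  by rewrite addrC => <-.
split=> // c q r; rewrite -lg; try exact: repr_in.
rewrite -[in LHS](clsK q) -[in LHS](clsK r) -cls_linear ?key //; try exact: repr_in.
by apply: hP.2; exact: repr_in.
Qed.

End Subquotient.

Section SubquotientMap.
Variables (F : fieldType) (V V' : lmodType F) (P N : V -> Prop) (P' N' : V' -> Prop).
Variables (hP : submod P) (hN : submod N) (hP' : submod P') (hN' : submod N').
Variables (g : {linear V -> V'}).
Hypotheses (gP : forall x, P x -> P' (g x)) (gN : forall x, N x -> N' (g x)).

Lemma subquot_map_spec : 
  (forall x, P x -> cls hP' hN' (g (repr (cls hP hN x))) = cls hP' hN' (g x)) /\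
  linear (fun q : subquot hP hN => cls hP' hN' (g (repr q))).
Proof.
apply: (@subquot_lift _ _ _ _ hP hN _ (fun x => cls hP' hN' (g x))).
- by move=> c x y px py; rewrite linearP cls_linear //; exact: gP.
- by move=> x px nx; apply/cls_eq0; [exact: gP | exact: gN].
Qed.

Definition subquot_map : {linear subquot hP hN -> subquot hP' hN'} :=
  linear_map subquot_map_spec.2.

Lemma subquot_mapE x : P x -> subquot_map (cls hP hN x) = cls hP' hN' (g x).
Proof. exact: subquot_map_spec.1. Qed.

End SubquotientMap.

Section SubquotientModule.
Variables (R : realType) (a b : R) (F : fieldType) (G : pmod a b F).
Variables (P N : forall u, pm_obj G u -> Prop).
Hypotheses (hP : forall u, submod (@P u)) (hN : forall u, submod (@N u)).
Hypothesis nP : forall u v (h : ple u v) x, P x -> P (pm_map G h x).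
Hypothesis nN : forall u v (h : ple u v) x, N x -> N (pm_map G h x).

Let M u v (h : ple u v) :=
  subquot_map (hP v) (hN v) (hP u) (hN u) (@nP u v h) (@nN u v h).

Let ME u v (h : ple u v) x (px : P x) :
  M h (cls (hP v) (hN v) x) = cls (hP u) (hN u) (pm_map G h x).
Proof. exact: subquot_mapE. Qed.

Definition subquot_pmod : pmod a b F.
Proof.
exists (fun u => subquot (hP u) (hN u) : lmodType F) M.
- by move=> u h; apply: cls_ind => x px; rewrite ME // pm_id.
- move=> u v w huv hvw huw; apply: cls_ind => x px.
  by rewrite (ME hvw px) (ME huv (nP hvw px)) (ME huw px) (pm_comp _ _ huw).
Defined.

Definition scls u (x : pm_obj G u) : pm_obj subquot_pmod u := cls (hP u) (hN u) x.

Lemma scls_rmap u v (x : pm_obj G v) : ple u v -> P x ->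
  rmap u (scls x) = scls (rmap u x).
Proof. by move=> uv px; rewrite !(rmapE uv); exact: subquot_mapE. Qed.

Lemma scls_linear u c (x y : pm_obj G u) : P x -> P y ->
  scls (c *: x + y) = c *: scls x + scls y.
Proof. exact: cls_linear. Qed.

Lemma scls_eq u (x y : pm_obj G u) : P x -> P y -> N (x - y) -> scls x = scls y.
Proof. exact: cls_eq. Qed.

Lemma scls_eq0 u (x : pm_obj G u) : P x -> (scls x = 0 <-> N x).
Proof. exact: cls_eq0. Qed.

Lemma scls_ind u (K : pm_obj subquot_pmod u -> Prop) :
  (forall x, P x -> K (scls x)) -> forall q, K q.
Proof. exact: cls_ind. Qed.

Lemma subquot_pmod_lift (X : pmod a b F) (g : forall u, pm_obj G u -> pm_obj X u) :
  (forall u c (x y : pm_obj G u), P x -> P y -> g u (c *: x + y) = c *: g u x + g u y) ->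
  (forall u (x : pm_obj G u), P x -> N x -> g u x = 0) ->
  (forall u v (x : pm_obj G v), ple u v -> P x -> g u (rmap u x) = rmap u (g v x)) ->
  exists f : pmor subquot_pmod X, forall u x, P x -> pmor_fun f u (scls x) = g u x.
Proof.
move=> lg kg ng; have spec u := subquot_lift (hP u) (hN u) (lg u) (kg u).
have [||f hf] := @pmor_make _ _ _ _ subquot_pmod X (fun u q => g u (repr q)).
- by move=> u; case: (spec u).
- move=> u v x uv; move: x; apply: scls_ind => x px; rewrite scls_rmap // (spec u).1.
    by rewrite (spec v).1 ?ng.
  by rewrite (rmapE uv); exact: nP.
by exists f => u x px; rewrite hf (spec u).1.
Qed.

End SubquotientModule.

(** * Pointwise kernels and cokernels *)

Section KernelsCokernels.
Variables (R : realType) (a b : R) (F : fieldType).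
Implicit Types A B : pmod a b F.

Lemma submod_zero (V : lmodType F) : submod (fun x : V => x = 0).
Proof. by split=> // c x y -> ->; rewrite scaler0 addr0. Qed.

Lemma submod_all (V : lmodType F) : submod (fun _ : V => True).
Proof. by []. Qed.

Lemma submod_ker (V W : lmodType F) (f : {linear V -> W}) : submod (fun x => f x = 0).
Proof. exact: (submod_preim f (submod_zero W)). Qed.

Lemma submod_im (V W : lmodType F) (f : {linear V -> W}) :
  submod (fun y => exists x, f x = y).
Proof.
split; first by exists 0; rewrite linear0.
by move=> c _ _ [x <-] [y <-]; exists (c *: x + y); rewrite linearP.
Qed.

Lemma kernel_exists A B (f : pmor A B) : exists K (k : pmor K A), is_kernel f k.
Proof.
pose P u (x : pm_obj A u) := pmor_fun f u x = 0.
pose N u (x : pm_obj A u) := x = 0.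
have nP u v (h : ple u v) (x : pm_obj A v) : P v x -> P u (pm_map A h x).
  by rewrite /P pmor_nat => ->; rewrite linear0.
have nN u v (h : ple u v) (x : pm_obj A v) : N v x -> N u (pm_map A h x).
  by rewrite /N => ->; rewrite linear0.
pose hP u : submod (P u) := submod_ker (pmor_fun f u).
pose hN u : submod (N u) := submod_zero (pm_obj A u).
have [||//|k hk] := @subquot_pmod_lift _ _ _ _ A P N hP hN nP nN A (fun u x => x) => //.
exists (subquot_pmod hP hN nP nN), k => u; split.
- by apply: scls_ind => x px; apply: scls_ind => y py; rewrite !hk // => ->.
- move=> y; split=> [fy|[q <-]]; first by exists (scls hP hN nP nN y); rewrite hk.
  by move: q; apply: scls_ind => x px; rewrite hk.
Qed.

Lemma cokernel_exists A B (f : pmor A B) : exists C (c : pmor B C), is_cokernel f c.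
Proof.
pose P u (x : pm_obj B u) := True.
pose N u (y : pm_obj B u) := exists x, pmor_fun f u x = y.
have nP u v (h : ple u v) (x : pm_obj B v) : P v x -> P u (pm_map B h x) by [].
have nN u v (h : ple u v) (y : pm_obj B v) : N v y -> N u (pm_map B h y).
  by move=> [x <-]; exists (pm_map A h x); rewrite pmor_nat.
pose hP u : submod (P u) := submod_all (pm_obj B u).
pose hN u : submod (N u) := submod_im (pmor_fun f u).
have [||c hc] := @pmor_make _ _ _ _ B (subquot_pmod hP hN nP nN) (scls hP hN nP nN).
- by move=> u k x y; exact: scls_linear.
- by move=> u v x uv; rewrite scls_rmap.
exists (subquot_pmod hP hN nP nN), c => u; split.
- by apply: scls_ind => x _; exists x.
- by move=> y; rewrite hc; exact: scls_eq0.
Qed.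

End KernelsCokernels.

(** * The cohomological functor of a bifiltered space *)

Section Bifiltered.
Variables (R : realType) (a b : R) (F : fieldType) (U : lmodType F).
Variable Fil : R -> R -> U -> Prop.
Hypothesis sFil : forall x y, submod (Fil x y).
Hypothesis monoFil : forall x y x' y' z, x <= x' -> y' <= y -> Fil x y z -> Fil x' y' z.
Hypothesis capFil : forall x y x' y' z, x <= x' -> y <= y' ->
  Fil x y z -> Fil x' y' z -> Fil x y' z.
Implicit Types u v p q r : pt a b.

Definition constant_pmod : pmod a b F.
Proof. by exists (fun=> U) (fun _ _ _ => idfun : {linear U -> U}). Defined.

Definition fil_in p (z : pm_obj constant_pmod p) := Fil (px p) (py p) z.

(** Only what comes from the boundary points (a - py p, py p) of l_0 and (px p, b - px p) of l_1 is
    divided out. *)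
Definition fil_null p (z : pm_obj constant_pmod p) := exists z1 z2,
  [/\ Fil (a - py p) (py p) z1, Fil (px p) (b - px p) z2 & z = z1 + z2].

Lemma submod_fil_in p : submod (@fil_in p). Proof. exact: sFil. Qed.

Lemma submod_fil_null p : submod (@fil_null p).
Proof.
split; first by exists 0, 0; rewrite addr0; split=> //; exact: submod0.
move=> c _ _ [x1 [x2 [h1 h2 ->]]] [y1 [y2 [k1 k2 ->]]].
exists (c *: x1 + y1), (c *: x2 + y2); rewrite scalerDr addrACA; split=> //.
- exact: (sFil _ _).2.
- exact: (sFil _ _).2.
Qed.

Lemma fil_in_map u v (h : ple u v) z : fil_in z -> fil_in (pm_map constant_pmod h z).
Proof. by apply: monoFil; [exact: ple_px | exact: ple_py]. Qed.

Lemma fil_null_map u v (h : ple u v) z : fil_null z -> fil_null (pm_map constant_pmod h z).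
Proof.
have hx := ple_px h; have hy := ple_py h.
move=> [z1 [z2 [h1 h2 ->]]]; exists z1, z2; split=> //.
- by apply: monoFil h1 => //; lra.
- by apply: monoFil h2 => //; lra.
Qed.

Definition bifiltered_pmod : pmod a b F :=
  subquot_pmod submod_fil_in submod_fil_null fil_in_map fil_null_map.

Definition bcls p (z : U) : pm_obj bifiltered_pmod p :=
  @scls _ _ _ _ constant_pmod _ _ submod_fil_in submod_fil_null fil_in_map fil_null_map p z.

Lemma bcls_rmap u v z : ple u v -> Fil (px v) (py v) z -> rmap u (bcls v z) = bcls u z.
Proof. by move=> uv hz; rewrite /bcls scls_rmap // (rmapE uv). Qed.

Lemma bcls_ind p (K : pm_obj bifiltered_pmod p -> Prop) :
  (forall z, Fil (px p) (py p) z -> K (bcls p z)) -> forall y, K y.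
Proof.
exact: (@scls_ind _ _ _ _ constant_pmod _ _ submod_fil_in submod_fil_null
  fil_in_map fil_null_map p K).
Qed.

Lemma bcls_eq p z z' : Fil (px p) (py p) z -> Fil (px p) (py p) z' ->
  @fil_null p (z - z') -> bcls p z = bcls p z'.
Proof. exact: scls_eq. Qed.

Lemma bcls_eq0 p z : Fil (px p) (py p) z -> (bcls p z = 0 <-> @fil_null p z).
Proof. exact: scls_eq0. Qed.

Lemma bifiltered_vanishes : vanishes_on_bd bifiltered_pmod.
Proof.
move=> p bd; apply: bcls_ind => z hz; apply/bcls_eq0 => //.
case: bd; rewrite -/(px p) -/(py p) => bd.
- exists z, 0; rewrite addr0; split=> //; last exact: submod0.
  by rewrite (_ : a - py p = px p) //; lra.
- exists 0, z; rewrite add0r; split=> //; first exact: submod0.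
  by rewrite (_ : b - px p = py p) //; lra.
Qed.

(** If z = z1 + z2 dies at [q], then z1 is already null at [p], as [p] and [q] have the same height.
    The rest z2 lies in the levels of [p] and of (px q, b - px q), and [capFil], the abstract form
    of an intersection of two filtrations, puts it into the level of [r]. *)
Lemma bifiltered_horizontal : exact_horizontal bifiltered_pmod.
Proof.
move=> p q r qy pqx rx ry.
have h1 := px_py_ge p; have h2 := px_py_le q.
have qp : ple q p by apply: ple_intro; lra.
have pr : ple p r by apply: ple_intro; lra.
apply: bcls_ind => z hz; split.
- rewrite bcls_rmap // bcls_eq0; last by apply: monoFil hz; lra.
  move=> [z1 [z2 [f1 f2 zE]]].
  have f1' : Fil (a - py p) (py p) z1 by rewrite -qy.
  have f2' : Fil (px p) (py p) z2.
    by rewrite -(addKr z1 z2) -zE addrC; apply: submodB => //; apply: monoFil f1'; lra.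
  have f3 : Fil (px p) (b - px q) z2 by apply: capFil f2' f2; lra.
  exists (bcls r z2); rewrite bcls_rmap ?rx ?ry //; apply: bcls_eq => //.
  exists (- z1), 0; rewrite zE opprD addrCA subrr; split=> //.
  + exact: submodN.
  + exact: submod0.
- move=> [x <-]; move: x; apply: bcls_ind => w fw.
  have fwp : Fil (px p) (py p) w by apply: monoFil fw; lra.
  rewrite !bcls_rmap // bcls_eq0; last by apply: monoFil fwp; lra.
  exists 0, w; rewrite add0r; split=> //; first exact: submod0.
  by apply: monoFil fw; lra.
Qed.

Lemma bifiltered_vertical : exact_vertical bifiltered_pmod.
Proof.
move=> p q r qx pqy ry rx.
have h1 := px_py_ge q; have h2 := px_py_le p.
have qp : ple q p by apply: ple_intro; lra.
have pr : ple p r by apply: ple_intro; lra.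
apply: bcls_ind => z hz; split.
- rewrite bcls_rmap // bcls_eq0; last by apply: monoFil hz; lra.
  move=> [z1 [z2 [f1 f2 zE]]].
  have f2' : Fil (px p) (b - px p) z2 by rewrite -qx.
  have f1' : Fil (px p) (py p) z1.
    by rewrite -(addrK z2 z1) -zE; apply: submodB => //; apply: monoFil f2'; lra.
  have f3 : Fil (a - py q) (py p) z1 by apply: capFil f1 f1'; lra.
  exists (bcls r z1); rewrite bcls_rmap ?rx ?ry //; apply: bcls_eq => //.
  exists 0, (- z2); rewrite zE opprD addrA subrr; split=> //.
  + exact: submod0.
  + exact: submodN.
- move=> [x <-]; move: x; apply: bcls_ind => w fw.
  have fwp : Fil (px p) (py p) w by apply: monoFil fw; lra.
  rewrite !bcls_rmap // bcls_eq0; last by apply: monoFil fwp; lra.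
  exists w, 0; rewrite addr0; split=> //; last exact: submod0.
  by apply: monoFil fw; lra.
Qed.

End Bifiltered.

(** * Weak kernels and cokernels *)

Section FiniteSums.
Variables (F : fieldType) (I : eqType).
Implicit Types (v w : I -> F^o) (s : seq I).

Definition supported s v := uniq s /\ forall i, i \notin s -> v i = 0.
Definition finsupp v := exists s, supported s v.

Definition support_seq v : seq I :=
  if pselect (finsupp v) is left h then sval (cid h) else [::].

(** Total in [v], with the empty sum as default when the support is infinite; by [fsumE] any
    duplicate-free list covering a finite support gives the same value. *)
Definition fsum (M : lmodType F) v (x : I -> M) : M :=
  \sum_(i <- support_seq v) v i *: x i.

Lemma fsumE (M : lmodType F) v (x : I -> M) s :
  supported s v -> fsum v x = \sum_(i <- s) v i *: x i.
Proof.
move=> sv; rewrite /fsum /support_seq; case: pselect => [h|]; last by case; exists s.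
have [us hs] := sv; have [ut ht] := proj2_sig (cid h); set t := sval _ in ut ht *.
rewrite (bigID (fun i => v i != 0)) [RHS](bigID (fun i => v i != 0)) /=.
congr (_ + _); last first.
  by rewrite !big1 // => i; rewrite negbK => /eqP ->; rewrite scale0r.
rewrite -big_filter -[RHS]big_filter; apply: perm_big; apply: uniq_perm.
- exact: filter_uniq.
- exact: filter_uniq.
- move=> i; rewrite !mem_filter; have [//|vi] := eqVneq (v i) 0.
  have /idP -> : i \in t by apply: contraT => /ht e; rewrite e eqxx in vi.
  by have /idP -> : i \in s by apply: contraT => /hs e; rewrite e eqxx in vi.
Qed.

Lemma supported_cat s t v w : supported s v -> supported t w ->
  supported (undup (s ++ t)) v /\ supported (undup (s ++ t)) w.
Proof.
move=> [_ hs] [_ ht]; split; (split; first exact: undup_uniq) => i;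
  rewrite mem_undup mem_cat negb_or => /andP[h1 h2]; [exact: hs | exact: ht].
Qed.

Lemma submod_finsupp : submod finsupp.
Proof.
split; first by exists [::].
move=> c v w [s sv] [t tw]; have [[us hv] [_ hw]] := supported_cat sv tw.
exists (undup (s ++ t)); split=> // i hi.
by rewrite -[LHS]/(c *: v i + w i) hv // hw // scaler0 addr0.
Qed.

Lemma fsum_linear (M : lmodType F) c v w (x : I -> M) : finsupp v -> finsupp w ->
  fsum (c *: v + w) x = c *: fsum v x + fsum w x.
Proof.
move=> [s sv] [t tw]; have [s1 s2] := supported_cat sv tw.
have s3 : supported (undup (s ++ t)) (c *: v + w).
  split; first exact: undup_uniq.
  by move=> i hi; rewrite -[LHS]/(c *: v i + w i) s1.2 // s2.2 // scaler0 addr0.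
rewrite (fsumE _ s1) (fsumE _ s2) (fsumE _ s3) scaler_sumr -big_split.
by apply: eq_bigr => i _; rewrite -[(c *: v + w) i]/(c * v i + w i) scalerDl scalerA.
Qed.

Lemma fsum0 (M : lmodType F) (x : I -> M) : fsum 0 x = 0.
Proof. by rewrite (@fsumE _ _ _ [::]) ?big_nil. Qed.

Lemma fsum_eq0 (M : lmodType F) v (x : I -> M) :
  finsupp v -> (forall i, v i != 0 -> x i = 0) -> fsum v x = 0.
Proof.
move=> [s sv] h; rewrite (fsumE _ sv) big1 // => i _.
by have [->|/h ->] := eqVneq (v i) 0; rewrite ?scale0r ?scaler0.
Qed.

Lemma linear_fsum (M M' : lmodType F) (g : {linear M -> M'}) v (x : I -> M) :
  g (fsum v x) = fsum v (fun i => g (x i)).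
Proof. by rewrite linear_sum; apply: eq_bigr => i _; rewrite linearZ. Qed.

Lemma eq_fsum (M : lmodType F) v (x y : I -> M) : finsupp v ->
  (forall i, v i != 0 -> x i = y i) -> fsum v x = fsum v y.
Proof.
move=> [s sv] h; rewrite !(fsumE _ sv); apply: eq_bigr => i _.
by have [->|/h ->] := eqVneq (v i) 0; rewrite ?scale0r.
Qed.

End FiniteSums.

Section Bounds.
Variables (R : realType) (a b : R) (F : fieldType) (I : Type) (pos : I -> pt a b).
Implicit Types v w : I -> F^o.

(** [right_bounded] and [below_bounded] are the levels A_x and C_y of the two filtrations spanned by
    the generators. *)
Definition right_bounded x v := forall i, x < px (pos i) -> v i = 0.
Definition below_bounded y v := forall i, py (pos i) < y -> v i = 0.

Lemma submod_right_bounded x : submod (right_bounded x).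
Proof.
split=> // c v w hv hw i hi.
by rewrite -[LHS]/(c *: v i + w i) hv // hw // scaler0 addr0.
Qed.

Lemma submod_below_bounded y : submod (below_bounded y).
Proof.
split=> // c v w hv hw i hi.
by rewrite -[LHS]/(c *: v i + w i) hv // hw // scaler0 addr0.
Qed.

Lemma right_bounded_le x x' v : x <= x' -> right_bounded x v -> right_bounded x' v.
Proof. by move=> xx hv i hi; apply: hv; exact: le_lt_trans hi. Qed.

Lemma below_bounded_le y y' v : y' <= y -> below_bounded y v -> below_bounded y' v.
Proof. by move=> yy hv i hi; apply: hv; exact: lt_le_trans yy. Qed.

Lemma bounded_ple p v i : right_bounded (px p) v -> below_bounded (py p) v ->
  v i != 0 -> ple p (pos i).
Proof.
move=> hr hb vi; apply: ple_intro; rewrite leNgt; apply: contra_neqN vi => h;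
  [exact: hr | exact: hb].
Qed.

(** Cutting at x = a - py p separates the entries that are null at p because of l_0 from those that
    are null because of l_1. *)
Definition left_part x v : I -> F^o := fun i => if px (pos i) <= x then v i else 0.

Lemma left_part_bounded x v : right_bounded x (left_part x v).
Proof. by move=> i; rewrite /left_part leNgt => ->. Qed.

Lemma left_part_right x y v : right_bounded y v -> right_bounded y (left_part x v).
Proof. by move=> h i /h; rewrite /left_part => ->; case: ifP. Qed.

Lemma left_part_below x y v : below_bounded y v -> below_bounded y (left_part x v).
Proof. by move=> h i /h; rewrite /left_part => ->; case: ifP. Qed.

End Bounds.

Lemma finsupp_left_part (R : realType) (a b : R) (F : fieldType) (I : eqType)
    (pos : I -> pt a b) x (v : I -> F^o) : finsupp v -> finsupp (left_part pos x v).
Proof.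
move=> [s [us hs]]; exists s; split=> // i /hs.
by rewrite /left_part => ->; case: ifP.
Qed.

(** * The cocone of the lifted map and its exact sequence *)

Section WeakKernel.
Variables (R : realType) (a b : R) (F : fieldType) (H G : pmod a b F) (f : pmor H G).
Variables (BH : frame H) (BG : frame G).
Hypotheses (vH : vanishes_on_bd H) (vG : vanishes_on_bd G).
Implicit Types p q r u : pt a b.

Local Notation V := (ix BH -> F^o).
Local Notation W := (ix BG -> F^o).
Local Notation crdH x := (fun i : ix BH => crd i x : F^o).
Local Notation crdG x := (fun j : ix BG => crd j x : F^o).
Local Notation posH := (@pos _ _ _ _ _ BH).
Local Notation posG := (@pos _ _ _ _ _ BG).

Definition coef (i : ix BH) (j : ix BG) : F^o := crd j (pmor_fun f _ (gen i)).
(** The matrix of [f] applied to a finitely supported [v]. No support condition is imposed on [W],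
    as [evG] reads only the finitely many coordinates in [act BG p]. *)
Definition lift_map (v : V) : W := fun j => fsum v (coef^~ j).

Lemma coef_neq0 i j : coef i j != 0 -> ple (posH i) (posG j).
Proof.
move=> h; have : j \in act BG (posH i) by apply: contra_neqT h; exact: crd_out.
by rewrite mem_act; exact: supp_ple.
Qed.

Lemma lift_linear c v w : finsupp v -> finsupp w ->
  lift_map (c *: v + w) = c *: lift_map v + lift_map w.
Proof. by move=> fv fw; apply/funext => j; exact: fsum_linear. Qed.

Lemma lift0 : lift_map 0 = 0.
Proof. by apply/funext => j; exact: fsum0. Qed.

Lemma liftN v : finsupp v -> lift_map (- v) = - lift_map v.
Proof.
move=> fv; rewrite -[- v]addr0 -scaleN1r lift_linear //; last first.
  exact: submod0 (submod_finsupp F _).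
by rewrite lift0 addr0 scaleN1r.
Qed.

Lemma lift_right x v : finsupp v -> right_bounded posH x v ->
  right_bounded posG x (lift_map v).
Proof.
move=> fv hv j hj; apply: fsum_eq0 => // i; apply: contra_neq_eq => c0.
by apply: hv; apply: lt_le_trans hj _; exact/ple_px/coef_neq0.
Qed.

Lemma lift_below y v : finsupp v -> below_bounded posH y v ->
  below_bounded posG y (lift_map v).
Proof.
move=> fv hv j hj; apply: fsum_eq0 => // i; apply: contra_neq_eq => c0.
by apply: hv; apply: le_lt_trans hj; exact/ple_py/coef_neq0.
Qed.

(** The cocone of [lift_map : V -> W]. To make this map strictly surjective along the
    boundary one adds to [V] two copies of [W] with filtrations spanned by boundary
    points; [al] and [- (lift_map v + al)] are the components in these copies of an
    element of the kernel. *)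
Definition cocone_fil (x y : R) (z : V * W) : Prop :=
  [/\ finsupp z.1, right_bounded posH x z.1, below_bounded posH y z.1,
      right_bounded posG (a - y) z.2 & below_bounded posG (b - x) (lift_map z.1 + z.2)].

Lemma submod_cocone x y : submod (cocone_fil x y).
Proof.
have sf := @submod_finsupp F (ix BH).
have sr := @submod_right_bounded; have sb := @submod_below_bounded.
split.
  split; try exact: submod0; rewrite lift0 addr0; exact: submod0 (sb _ _ _ _ _ _ _).
move=> c z w [f1 f2 f3 f4 f5] [g1 g2 g3 g4 g5]; split.
- exact: sf.2.
- exact: (sr _ _ _ _ _ _ _).2.
- exact: (sb _ _ _ _ _ _ _).2.
- exact: (sr _ _ _ _ _ _ _).2.
- rewrite lift_linear //= addrACA -scalerDr; exact: (sb _ _ _ _ _ _ _).2.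
Qed.

Lemma cocone_mono x y x' y' z : x <= x' -> y' <= y -> cocone_fil x y z -> cocone_fil x' y' z.
Proof.
move=> xx yy [f1 f2 f3 f4 f5]; split=> //.
- exact: right_bounded_le f2.
- exact: below_bounded_le f3.
- by apply: right_bounded_le f4; lra.
- by apply: below_bounded_le f5; lra.
Qed.

Lemma cocone_cap x y x' y' z : x <= x' -> y <= y' ->
  cocone_fil x y z -> cocone_fil x' y' z -> cocone_fil x y' z.
Proof. by move=> xx yy [f1 f2 f3 f4 f5] [g1 g2 g3 g4 g5]; split. Qed.

Definition cocone : pmod a b F :=
  bifiltered_pmod a b submod_cocone cocone_mono.

Definition ccls p (v : V) (al : W) : pm_obj cocone p :=
  bcls submod_cocone cocone_mono p (v, al).

Definition evH p (v : V) : pm_obj H p := fsum v (fun i => rmap p (gen i)).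
Definition evG p (w : W) : pm_obj G p := \sum_(j <- act BG p) w j *: rmap p (gen j).

Lemma evG_linear p c w w' : evG p (c *: w + w') = c *: evG p w + evG p w'.
Proof.
rewrite /evG scaler_sumr -big_split; apply: eq_bigr => j _.
by rewrite -[(c *: w + w') j]/(c * w j + w' j) scalerDl scalerA.
Qed.

Lemma crd_evG p w j : j \in act BG p -> crd j (evG p w) = w j.
Proof. exact: crd_gen. Qed.

Lemma evG_crd p (x : pm_obj G p) : evG p (crdG x) = x.
Proof. by rewrite /evG -crd_sum. Qed.

Lemma evG_eq0 p w : (forall j, j \in act BG p -> w j = 0) -> evG p w = 0.
Proof. by move=> h; rewrite /evG big1_seq // => j /andP[_ /h ->]; rewrite scale0r. Qed.

Lemma evG_right p w : right_bounded posG (a - py p) w -> evG p w = 0.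
Proof.
move=> h; apply: evG_eq0 => j; rewrite mem_act => /and3P[_ h1 _]; apply: h; lra.
Qed.

Lemma evG_below p w : below_bounded posG (b - px p) w -> evG p w = 0.
Proof.
move=> h; apply: evG_eq0 => j; rewrite mem_act => /and3P[_ _ h1]; apply: h; lra.
Qed.

Lemma crd_bounded p (x : pm_obj G p) :
  right_bounded posG (px p) (crdG x) /\
  below_bounded posG (py p) (crdG x).
Proof.
by split=> j hj; rewrite crd_out // mem_act; apply/negP => /supp_ple h;
  have := ple_px h; have := ple_py h; lra.
Qed.

Lemma crdH_bounded p (x : pm_obj H p) :
  [/\ finsupp (crdH x), right_bounded posH (px p) (crdH x)
    & below_bounded posH (py p) (crdH x)].
Proof.
split; first by exists (act BH p); split; [exact: act_uniq | move=> i hi; rewrite crd_out].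
all: by move=> j hj; rewrite crd_out // mem_act; apply/negP => /supp_ple h;
  have := ple_px h; have := ple_py h; lra.
Qed.

Lemma evH_crd p (x : pm_obj H p) : evH p (crdH x) = x.
Proof.
rewrite /evH (@fsumE _ _ _ _ _ (act BH p)) -?crd_sum //.
by split; [exact: act_uniq | move=> i hi; rewrite crd_out].
Qed.

Lemma crd_evH p v i : finsupp v -> i \in act BH p -> crd i (evH p v) = v i.
Proof.
move=> [s [us hs]] ip; rewrite /evH (fsumE _ (conj us hs)).
rewrite (bigID (fun i => i \in act BH p)) /= [X in _ + X]big1 ?addr0; last first.
  by move=> j; rewrite mem_act => nj; rewrite rmap_unsupp ?scaler0.
rewrite -big_filter -[RHS](crd_gen v ip); congr (crd _ _).
rewrite [RHS](bigID (fun i => i \in s)) /= [X in _ = _ + X]big1 ?addr0; last first.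
  by move=> j /hs ->; rewrite scale0r.
rewrite -[RHS]big_filter; apply: perm_big; apply: uniq_perm; rewrite ?filter_uniq ?act_uniq //.
by move=> j; rewrite !mem_filter andbC.
Qed.

Lemma f_evH p v : finsupp v -> right_bounded posH (px p) v -> below_bounded posH (py p) v ->
  pmor_fun f p (evH p v) = evG p (lift_map v).
Proof.
move=> fv h1 h2; apply: (frame_eq (B := BG)) => j jp; rewrite crd_evG //.
case: fv => s sv; rewrite /evH /lift_map (fsumE _ sv) (fsumE _ sv) linear_sum.
have crdS (t : seq (ix BH)) (E : ix BH -> pm_obj G p) :
    crd j (\sum_(i <- t) E i) = \sum_(i <- t) (crd j (E i) : F^o).
  elim: t => [|i t IH]; first by rewrite !big_nil crd0.
  by rewrite !big_cons -IH -[E i]scale1r crd_linear mul1r scale1r.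
rewrite crdS; apply: eq_bigr => i _.
have [->|vi] := eqVneq (v i) 0; first by rewrite !scale0r linear0 crd0.
rewrite linearZ /= crdZ pmor_rmap crd_rmap //.
exact: bounded_ple vi.
Qed.

(** The hypotheses say q = T^{-1} p. For v = 0 the two bounds of [cocone_fil] at q are the
    filtration bounds of W at p, which is the origin of the shift by T in the exact sequence. *)
Lemma cocone_in_G p q w : px q = b - py p -> py q = a - px p ->
  right_bounded posG (px p) w -> below_bounded posG (py p) w ->
  cocone_fil (px q) (py q) (0, w).
Proof.
move=> qx qy h1 h2; split=> //=; try exact: submod0.
- by exists [::].
- by rewrite qy (_ : a - _ = px p) //; lra.
- by rewrite lift0 add0r qx (_ : b - _ = py p) //; lra.
Qed.

(** A nonzero entry of w outside the blocks at p has px at most a - py p or py at least b - px p.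
    [left_part] separates these two kinds, and each is null for one boundary point of q. *)
Lemma cocone_null_G p q w : px q = b - py p -> py q = a - px p ->
  right_bounded posG (px p) w -> below_bounded posG (py p) w ->
  (forall j, j \in act BG p -> w j = 0) ->
  fil_null (a := a) (b := b) cocone_fil (p := q) (0, w).
Proof.
move=> qx qy h1 h2 h0; pose w1 := left_part posG (a - py p) w.
have f0 : finsupp (0 : V) by exists [::].
exists (0, w - w1), (0, w1); split; last by rewrite -[RHS]/(0 + 0, w - w1 + w1) addr0 subrK.
- split=> //=.
  + rewrite qy (_ : a - _ = px p); last by lra.
    apply: (submodB (submod_right_bounded F posG (px p))) => //.
    exact: (left_part_right _ h1).
  + rewrite lift0 add0r (_ : b - _ = b - px p); last by lra.
    move=> j hj; rewrite -[LHS]/(w j - w1 j) /w1 /left_part.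
    case: leP => jx; first by rewrite subrr.
    rewrite subr0; have [//|wj] := eqVneq (w j) 0; rewrite h0 // mem_act /supp.
    by rewrite (bounded_ple h1 h2 wj) /=; apply/andP; split; lra.
- split=> //=.
  + rewrite (_ : a - _ = a - py p); last by lra.
    exact: left_part_bounded.
  + rewrite lift0 add0r qx (_ : b - _ = py p); last by lra.
    exact: (left_part_below _ h2).
Qed.

Lemma ccls_agree p q w w' : px q = b - py p -> py q = a - px p ->
  right_bounded posG (px p) w -> below_bounded posG (py p) w ->
  right_bounded posG (px p) w' -> below_bounded posG (py p) w' ->
  (forall j, j \in act BG p -> w j = w' j) -> ccls q 0 w = ccls q 0 w'.
Proof.
move=> qx qy h1 h2 h1' h2' e; apply: bcls_eq.
- exact: cocone_in_G qx qy h1 h2.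
- exact: cocone_in_G qx qy h1' h2'.
- have -> : (0, w) - (0, w') = (0, w - w') :> V * W.
    by rewrite -[LHS]/(0 - 0, w - w') subr0.
  apply: cocone_null_G qx qy _ _ _.
  + exact: (submodB (submod_right_bounded F posG (px p))).
  + exact: (submodB (submod_below_bounded F posG (py p))).
  + by move=> j /e ej; rewrite -[LHS]/(w j - w' j) ej subrr.
Qed.

Definition projects (l : pmor cocone H) : Prop := forall p v al,
  cocone_fil (px p) (py p) (v, al) -> pmor_fun l p (ccls p v al) = evH p v.

Lemma cocone_projection : exists l, projects l.
Proof.
have [|||l hl] := @subquot_pmod_lift _ _ _ _ (constant_pmod a b (V * W)%type) _ _
  (submod_fil_in submod_cocone) (submod_fil_null submod_cocone)
  (fil_in_map cocone_mono) (fil_null_map cocone_mono) H (fun p z => evH p z.1).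
- by move=> p c z w [fz _ _ _ _] [fw _ _ _ _]; exact: fsum_linear.
- move=> p z _ [z1 [z2 [[f1 r1 b1 _ _] [f2 r2 b2 _ _] ->]]].
  rewrite /evH -[(z1 + z2).1]/(z1.1 + z2.1) -[z1.1]scale1r fsum_linear // scale1r.
  rewrite (@fsum_eq0 _ _ _ z1.1) // ?(@fsum_eq0 _ _ _ z2.1) ?addr0 // => i vi.
  + apply: rmap_bd => //; right; rewrite -lerBlDl leNgt.
    by apply: contra_neqN vi => h; exact: b2.
  + apply: rmap_bd => //; left; rewrite -lerBrDr leNgt.
    by apply: contra_neqN vi => h; exact: r1.
- move=> u v z uv [fz rz bz _ _]; rewrite (rmapE uv) /= /evH.
  have -> : rmap u (fsum z.1 (fun i => rmap v (gen i))) =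
            fsum z.1 (fun i => rmap u (rmap v (gen i))).
    exact: (linear_fsum (@rmap _ a b F H u v : {linear _ -> _})).
  apply: eq_fsum => // i vi; rewrite rmap_comp //; exact: bounded_ple vi.
by exists l => p v al h; exact: hl.
Qed.

(** The connecting map G(p) -> L(q) of the exact sequence when q = T^{-1} p. By [ccls_agree], any
    other bounded vector with the same coordinates at p gives the same class. *)
Definition connecting p q (x : pm_obj G p) : pm_obj cocone q :=
  ccls q 0 (crdG x).

Lemma connecting_linear p q c (x y : pm_obj G p) : px q = b - py p -> py q = a - px p ->
  connecting q (c *: x + y) = c *: connecting q x + connecting q y.
Proof.
move=> qx qy; have [x1 x2] := crd_bounded x; have [y1 y2] := crd_bounded y.
rewrite /connecting /ccls /bcls -scls_linear; try exact: cocone_in_G qx qy _ _.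
congr (scls _ _ _ _ _).
rewrite -[RHS]/(c *: 0 + 0, _) scaler0 addr0; congr pair.
by apply/funext => j; rewrite crd_linear.
Qed.

Lemma connecting_rmap p q p' q' (x : pm_obj G p') :
  px q = b - py p -> py q = a - px p -> px q' = b - py p' -> py q' = a - px p' ->
  ple p p' -> rmap q (connecting q' x) = connecting q (rmap p x).
Proof.
move=> qx qy qx' qy' pp.
have hx := ple_px pp; have hy := ple_py pp.
have qq : ple q q' by apply: ple_intro; lra.
have [x1 x2] := crd_bounded x; have [y1 y2] := crd_bounded (rmap p x).
rewrite /connecting /ccls bcls_rmap //; last exact: cocone_in_G qx' qy' _ _.
apply: (@ccls_agree p q) => //.
- exact: right_bounded_le x1.
- exact: below_bounded_le x2.
- by move=> j jp; rewrite crd_rmap.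
Qed.

Lemma connecting_exact p q (x : pm_obj G p) : px q = b - py p -> py q = a - px p ->
  connecting q x = 0 <-> exists h, pmor_fun f p h = x.
Proof.
move=> qx qy; have [x1 x2] := crd_bounded x.
have g1 := px_py_ge p; have g2 := px_py_le p.
have sv := submod_finsupp F (ix BH).
rewrite /connecting /ccls bcls_eq0; last exact: cocone_in_G qx qy _ _.
split.
(* Since v1 = - v2 satisfies bounds from both summands, it lies in the level of [p]. The bounds on
   al1 and al2 then show, after evaluation at [p], that x is the image of - v1. *)
- move=> [[v1 al1] [[v2 al2] [[/= f1 r1 b1 s1 t1] [/= f2 r2 b2 s2 t2] e]]].
  have [e1 e2] : 0 = v1 + v2 /\ crdG x = al1 + al2 by case: e.
  have b1' : below_bounded posH (py p) v1.
    have -> : v1 = - v2 by apply/eqP; rewrite -addr_eq0 -e1.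
    apply: (submodN (submod_below_bounded F posH _)).
    by apply: below_bounded_le b2; lra.
  have r1' : right_bounded posH (px p) v1 by apply: right_bounded_le r1; lra.
  exists (- evH p v1); rewrite linearN f_evH //.
  rewrite -[RHS]evG_crd e2 -[al1]scale1r evG_linear scale1r.
  rewrite (@evG_right _ al2) ?addr0; last by apply: right_bounded_le s2; lra.
  have /eqP : evG p (lift_map v1) + evG p al1 = 0.
    rewrite -[evG p (lift_map v1)]scale1r -evG_linear scale1r.
    by apply: evG_below; apply: below_bounded_le t1; lra.
  by rewrite addrC addr_eq0 => /eqP ->.
- move=> [h hx]; have [fh rh bh] := crdH_bounded h.
  set v : V := crdH h in fh rh bh.
  have agree j : j \in act BG p -> crd j x - lift_map v j = 0.
    by move=> jp; rewrite -hx -[h in crd _ (_ h)]evH_crd f_evH // crd_evG // subrr.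
  have rl := lift_right fh rh; have bl := lift_below fh bh.
  (* The first summand has no coordinates at [p]; the other two are null for the two boundary points
     of [q]. *)
  have -> : (0, crdG x) =
     (0, crdG x - lift_map v) + ((- v, lift_map v) + (v, 0)) :> V * W.
    rewrite -[RHS]/(0 + (- v + v), _ - lift_map v + (lift_map v + 0)).
    by rewrite addNr !addr0 subrK.
  have sN := submod_fil_null submod_cocone q.
  apply: (submodD sN).
    apply: cocone_null_G qx qy _ _ _ => //.
    + exact: (submodB (submod_right_bounded F posG (px p))).
    + exact: (submodB (submod_below_bounded F posG (py p))).
  exists (- v, lift_map v), (v, 0); split=> //; split=> //=.
  + exact: submodN.
  + apply: (submodN (submod_right_bounded F posH _)).
    by apply: right_bounded_le rh; lra.
  + apply: (submodN (submod_below_bounded F posH _)).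
    by apply: below_bounded_le bh; lra.
  + by apply: right_bounded_le rl; lra.
  + rewrite liftN // addNr; exact: (submod0 (submod_below_bounded F posG _)).
  + by apply: right_bounded_le rh; lra.
  + by apply: below_bounded_le bh; lra.
  + by rewrite addr0; apply: below_bounded_le bl; lra.
Qed.

Lemma projection_exact l p : projects l -> exact_at (pmor_fun l p) (pmor_fun f p).
Proof.
move=> hl x; split; last first.
  move=> [y <-]; move: y; apply: bcls_ind => -[v al] hz; rewrite [pmor_fun l p _]hl //.
  case: hz => /= fv rv bv s t; rewrite f_evH //.
  rewrite -[RHS](evG_below t) -[lift_map v in RHS]scale1r evG_linear scale1r.
  by rewrite (evG_right s) addr0.
move=> fx; have [fv rv bv] := crdH_bounded x; set v : V := crdH x in fv rv bv.
have rl := lift_right fv rv; have bl := lift_below fv bv.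
(* As f x = 0, the lift of [v] has no coordinates at [p]; removing its part towards l_0 leaves only
   entries of height at least b - px p. *)
exists (ccls p v (- left_part posG (a - py p) (lift_map v))).
rewrite hl; first exact: evH_crd.
split=> //=.
- apply: (submodN (submod_right_bounded F posG _)); exact: left_part_bounded.
- move=> j hj; rewrite -[LHS]/(lift_map v j - left_part _ _ _ j) /left_part.
  case: leP => jx; first by rewrite subrr.
  rewrite subr0; have [//|vj] := eqVneq (lift_map v j) 0.
  have jp : j \in act BG p.
    by rewrite mem_act /supp (bounded_ple rl bl vj) /=; apply/andP; split; lra.
  by rewrite -(crd_evG _ jp) -f_evH // evH_crd fx crd0.
Qed.

Lemma projection_kernel l p q (y : pm_obj cocone q) : projects l ->
  px p = a - py q -> py p = b - px q ->
  pmor_fun l q y = 0 <-> exists x : pm_obj G p, connecting q x = y.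
Proof.
move=> hl epx epy; have qx : px q = b - py p by lra.
have qy : py q = a - px p by lra.
have g1 := px_py_ge q; have g2 := px_py_le q.
have sF := submod_finsupp F (ix BH).
split; last first.
  move=> [x <-]; have [x1 x2] := crd_bounded x.
  by rewrite /connecting hl ?/evH ?fsum0 //; exact: cocone_in_G qx qy _ _.
move: y; apply: bcls_ind => -[v al] hz; rewrite [pmor_fun l q _]hl // => ev0.
have [/= fv rv bv s t] := hz.
pose v1 := left_part posH (a - py q) v; pose v2 : V := v - v1.
have f1 : finsupp v1 := finsupp_left_part posH _ fv.
have r1 : right_bounded posH (a - py q) v1 by exact: left_part_bounded.
have b1 : below_bounded posH (py q) v1 := left_part_below _ bv.
have f2 : finsupp v2 := submodB sF fv f1.
have r2 : right_bounded posH (px q) v2.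
  by apply: (submodB (submod_right_bounded F posH _)) => //; exact: left_part_right.
have b2 : below_bounded posH (b - px q) v2.
  move=> i hi; rewrite -[LHS]/(v i - v1 i) /v1 /left_part.
  case: leP => ix_; first by rewrite subrr.
  rewrite subr0; have [//|vi] := eqVneq (v i) 0.
  have iq : i \in act BH q.
    by rewrite mem_act /supp (bounded_ple rv bv vi) /=; apply/andP; split; lra.
  by rewrite -(crd_evH fv iq) ev0 crd0.
have liftE : lift_map v = lift_map v1 + lift_map v2.
  by rewrite -[v](subrK v1) -/v2 -[v2]scale1r lift_linear // !scale1r addrC.
(* Both parts of [v] are null because [v] evaluates to 0. Subtracting the null elements (v1, -
   lift_map v1) and (v2, 0) from (v, al) leaves (0, be). *)
pose be : W := al + lift_map v1.
have rbe : right_bounded posG (px p) be.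
  rewrite epx; apply: (submodD (submod_right_bounded F posG _)) => //.
  exact: lift_right.
have bbe : below_bounded posG (py p) be.
  have -> : be = (lift_map v + al) - lift_map v2.
    by rewrite liftE addrAC addrK addrC.
  rewrite epy; apply: (submodB (submod_below_bounded F posG _)) => //.
  exact: lift_below.
exists (evG p be); have [x1 x2] := crd_bounded (evG p be).
rewrite /connecting (@ccls_agree p q _ be) //; last by move=> j jp; rewrite crd_evG.
apply: bcls_eq => //; first exact: cocone_in_G qx qy _ _.
exists (- v1, lift_map v1), (- v2, 0); split.
- split=> //=.
  + exact: submodN.
  + exact: (submodN (submod_right_bounded F posH _)).
  + exact: (submodN (submod_below_bounded F posH _)).
  + exact: lift_right.
  + rewrite liftN // addNr; exact: (submod0 (submod_below_bounded F posG _)).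
- split=> //=.
  + exact: submodN.
  + exact: (submodN (submod_right_bounded F posH _)).
  + exact: (submodN (submod_below_bounded F posH _)).
  + rewrite liftN // addr0; apply: (submodN (submod_below_bounded F posG _)).
    exact: lift_below.
- rewrite -[LHS]/(0 - v, be - al) -[RHS]/(- v1 - v2, lift_map v1 + 0).
  congr pair; last by rewrite addr0 /be addrC addKr.
  by rewrite sub0r /v2 opprB addrA addNr add0r.
Qed.

End WeakKernel.

(** [B] is spanned by the images of generators of [A] and lifts of a spanning family of the image of
    [g]. *)
Lemma fin_dim_exact (F : fieldType) (A B C : lmodType F) (f : {linear A -> B})
    (g : {linear B -> C}) :
  (forall y, g y = 0 -> exists x, f x = y) -> fin_dim A -> fin_dim C -> fin_dim B.
Proof.
move=> ex [n [e he]] /fin_dim_cover[m [p hp]].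
have [X hX] := submod_vspace (submod_preim p (submod_im g)).
pose w (i : 'I_(\dim X)) := (vbasis X)`_i.
have wX i : exists y, g y = p (w i).
  by apply/hX; apply: vbasis_mem; apply: mem_nth; rewrite size_tuple.
have [z hz] := choice wX.
exists (n + \dim X)%N,
  (fun i => match fintype.split i with inl k => f (e k) | inr k => z k end) => y.
have [r rE] := hp (g y).
have rX : r \in X by apply/hX; exists y.
pose d k := coord (vbasis X) k r.
have [x hx] : exists x, f x = y - \sum_k d k *: z k.
  apply: ex; rewrite linearB linear_sum -rE {1}(coord_vbasis rX) linear_sum.
  rewrite -sumrB big1 // => k _; rewrite !linearZ /= hz.
  by rewrite scalerN subrr.
have [c hc] := he x.
exists (fun i => match fintype.split i with inl k => c k | inr k => d k end).
rewrite big_split_ord /=.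
rewrite -[LHS](subrK (\sum_k d k *: z k)) -hx hc linear_sum; congr (_ + _).
- apply: eq_bigr => k _; rewrite linearZ; case: splitP => j.
  + by move=> /= /val_inj ->.
  + by move=> /= e'; have := ltn_ord k; rewrite e' ltnNge leq_addr.
- apply: eq_bigr => k _; case: splitP => j.
  + by move=> /= e'; have := ltn_ord j; rewrite -e' ltnNge leq_addr.
  + by move=> /= /addnI/val_inj ->.
Qed.

(** * Order, convergence and the automorphism T on the strip *)

Section Strip.
Local Open Scope classical_set_scope.
Variables (R : realType) (a b : R).
Implicit Types u v w : pt a b.

Lemma px_Tmap u : px (Tmap u) = a - py u. Proof. by []. Qed.
Lemma py_Tmap u : py (Tmap u) = b - px u. Proof. by []. Qed.
Lemma px_Tinv u : px (Tinv u) = b - py u. Proof. by []. Qed.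
Lemma py_Tinv u : py (Tinv u) = a - px u. Proof. by []. Qed.

Lemma ple_Tmap u v : ple u v -> ple (Tmap u) (Tmap v).
Proof.
by move=> uv; apply: ple_intro; rewrite ?px_Tmap ?py_Tmap lerD2l lerN2;
  [exact: ple_py | exact: ple_px].
Qed.

Lemma ple_Tinv u v : ple u v -> ple (Tinv u) (Tinv v).
Proof.
by move=> uv; apply: ple_intro; rewrite ?px_Tinv ?py_Tinv lerD2l lerN2;
  [exact: ple_py | exact: ple_px].
Qed.

Lemma TinvK u : Tmap (Tinv u) = u.
Proof. by apply: pt_eq; rewrite ?px_Tmap ?py_Tmap ?px_Tinv ?py_Tinv; lra. Qed.

Lemma ple_Tmap_self u : ple u (Tmap u).
Proof.
have := px_py_ge u; have := px_py_le u => h1 h2.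
by apply: ple_intro; rewrite ?px_Tmap ?py_Tmap; lra.
Qed.

(** A common upper bound can be placed on l_1, with first coordinate at most px and b - py of both
    points. *)
Lemma ple_upper_bound u v : exists w, ple u w /\ ple v w.
Proof.
pose x := Num.min (Num.min (px u) (px v)) (Num.min (b - py u) (b - py v)).
have : x <= x by []; rewrite {2}/x !le_min => /andP[/andP[h1 h2] /andP[h3 h4]].
have g1 := px_py_ge u; have g2 := px_py_le u.
have [||w [wx wy]] := @pt_make _ a b x (b - x); [lra|lra|].
by exists w; split; apply: ple_intro; lra.
Qed.

Lemma cvg_coord (us : nat -> pt a b) u :
  (fun k => sval (us k)) @ \oo --> sval u ->
  (fun k => px (us k)) @ \oo --> px u /\ (fun k => py (us k)) @ \oo --> py u.
Proof.
move=> cv; split.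
- by apply: (cvg_comp _ _ cv); exact: cvg_fst.
- by apply: (cvg_comp _ _ cv); exact: cvg_snd.
Qed.

Lemma cvg_pt (us : nat -> pt a b) u :
  (fun k => px (us k)) @ \oo --> px u -> (fun k => py (us k)) @ \oo --> py u ->
  (fun k => sval (us k)) @ \oo --> sval u.
Proof.
move=> cx cy.
have -> : (fun k => sval (us k)) = (fun k => (px (us k), py (us k))).
  by apply/funext => k; rewrite [LHS]surjective_pairing.
rewrite [sval u]surjective_pairing.
exact: (@cvg_pair _ _ _ _ (nbhs (px u)) (nbhs (py u))).
Qed.

Lemma ple_limit (us : nat -> pt a b) u : (forall k, ple (us k) (us k.+1)) ->
  (fun k => sval (us k)) @ \oo --> sval u -> forall k, ple (us k) u.
Proof.
move=> incr /cvg_coord[cx cy] k; have mono := ple_seq incr; apply: ple_intro.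
- rewrite -(cvg_lim (@Rhausdorff R) cx).
  apply: (nonincreasing_cvgn_ge (u_ := fun k => px (us k))).
    by move=> m n /mono/ple_px.
  by apply/cvg_ex; exists (px u).
- rewrite -(cvg_lim (@Rhausdorff R) cy).
  apply: (nondecreasing_cvgn_le (u_ := fun k => py (us k))).
    by move=> m n /mono/ple_py.
  by apply/cvg_ex; exists (py u).
Qed.

Lemma cvg_Tmap (us : nat -> pt a b) u :
  (fun k => sval (us k)) @ \oo --> sval u ->
  (fun k => sval (Tmap (us k))) @ \oo --> sval (Tmap u).
Proof.
move=> /cvg_coord[cx cy]; apply: cvg_pt.
- by under eq_fun do rewrite px_Tmap; apply: cvgB; [exact: cvg_cst | exact: cy].
- by under eq_fun do rewrite py_Tmap; apply: cvgB; [exact: cvg_cst | exact: cx].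
Qed.

Lemma cvg_Tinv (us : nat -> pt a b) u :
  (fun k => sval (us k)) @ \oo --> sval u ->
  (fun k => sval (Tinv (us k))) @ \oo --> sval (Tinv u).
Proof.
move=> /cvg_coord[cx cy]; apply: cvg_pt.
- by under eq_fun do rewrite px_Tinv; apply: cvgB; [exact: cvg_cst | exact: cy].
- by under eq_fun do rewrite py_Tinv; apply: cvgB; [exact: cvg_cst | exact: cx].
Qed.

End Strip.

(** * Precomposition with T^{-1} *)

Section Shift.
Variables (R : realType) (a b : R) (F : fieldType) (G : pmod a b F).
Implicit Types u v w : pt a b.

Definition pm_shift : pmod a b F.
Proof.
exists (fun u => pm_obj G (Tinv u)) (fun u v h => pm_map G (ple_Tinv h)).
- by move=> u h x; exact: pm_id.
- by move=> u v w huv hvw huw x; exact: pm_comp.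
Defined.

Lemma rmap_shift u v (x : pm_obj G (Tinv v)) : ple u v ->
  @rmap _ _ _ _ pm_shift u v x = rmap (Tinv u) x.
Proof. by move=> uv; rewrite (rmapE uv) (rmapE (ple_Tinv uv)). Qed.

(** T^{-1} exchanges l_0 with l_1 and horizontal with vertical segments, hence also the two
    exactness conditions. *)
Lemma inJ_shift : inJ G -> inJ pm_shift.
Proof.
move=> [fG [/cohomologicalE[vG hG eG] [cG [w bG]]]].
have ex p q r : ple p r -> ple q p ->
    exact_at (@rmap _ a b F G (Tinv p) (Tinv r)) (@rmap _ a b F G (Tinv q) (Tinv p)) ->
    exact_at (@rmap _ a b F pm_shift p r) (@rmap _ a b F pm_shift q p).
  move=> pr qp e y; rewrite rmap_shift //; apply: iff_trans (e y) _.
  by split=> -[x hx]; exists x; move: hx; rewrite rmap_shift.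
split; first by move=> u; exact: fG.
split; first (apply/cohomologicalE; split).
- move=> u bd; apply: vG; case: bd; rewrite -/(px u) -/(py u) => bd.
  + by right; rewrite -/(px (Tinv u)) -/(py (Tinv u)) px_Tinv py_Tinv; lra.
  + by left; rewrite -/(px (Tinv u)) -/(py (Tinv u)) px_Tinv py_Tinv; lra.
- move=> p q r qy pq rx ry.
  have h1 := px_py_le q; have h2 := px_py_ge p.
  apply: ex; [apply: ple_intro; lra | apply: ple_intro; lra |].
  by apply: eG; rewrite ?px_Tinv ?py_Tinv; lra.
- move=> p q r qx pq ry rx.
  have h1 := px_py_ge q; have h2 := px_py_ge p.
  apply: ex; [apply: ple_intro; lra | apply: ple_intro; lra |].
  by apply: hG; rewrite ?px_Tinv ?py_Tinv; lra.
split.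
- move=> us u incr cv.
  have uu := ple_limit incr cv.
  have [h1 h2] := cG (fun k => Tinv (us k)) (Tinv u) (fun k => ple_Tinv (incr k)) (cvg_Tinv cv).
  split.
  + by move=> x hx; apply: h1 => k; rewrite -(rmap_shift x (uu k)); exact: hx.
  + move=> xs hxs; have [k|x hx] := h2 xs; first by rewrite -(rmap_shift _ (incr k)); exact: hxs.
    by exists x => k; rewrite (rmap_shift x (uu k)); exact: hx.
- exists (Tmap w) => u nu x; apply: bG; apply: contra nu => h.
  by rewrite -[u]TinvK; exact: ple_Tmap.
Qed.

End Shift.

Section FiveLemma.
Variables (R : realType) (a b : R) (F : fieldType) (H G L : pmod a b F).
Variables (f : pmor H G) (l : pmor L H) (d : forall u, {linear pm_obj G (Tmap u) -> pm_obj L u}).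
Hypothesis dnat : forall u v (x : pm_obj G (Tmap v)), ple u v ->
  rmap u (d v x) = d u (rmap _ x).
Hypothesis lE : forall u, exact_at (pmor_fun l u) (pmor_fun f u).
Hypothesis lK : forall u (y : pm_obj L u), pmor_fun l u y = 0 <-> exists x, d u x = y.
Hypothesis dE : forall u x, d u x = 0 <-> exists h, pmor_fun f _ h = x.

(** Five lemma for [H(Tu) -> G(Tu) -> L(u) -> H(u) -> G(u)]. *)
Lemma inJ_five : inJ H -> inJ G -> cohomological L -> inJ L.
Proof.
move=> [fH [_ [cH [wH bH]]]] [fG [_ [cG [wG bG]]]] coL.
split; [|split; [|split]].
- by move=> u; apply: (fin_dim_exact (f := d u) (g := pmor_fun l u)) => // y /lK.
- exact: coL.
- move=> us u incr cv; have uu := ple_limit incr cv.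
  have incrT k := ple_Tmap (incr k); have cvT := cvg_Tmap cv.
  split.
  + move=> y hy.
    have /lK[x xy] : pmor_fun l u y = 0.
      by apply: (cH us u incr cv).1 => k; rewrite -pmor_rmap hy linear0.
    (* Each restriction of [x] is hit by [f]; the preimages form affine sets, so a compatible choice
       [h] exists in the limit. *)
    have [|||h hh] := @seq_limit_point _ _ _ _ H (fun k => Tmap (us k)) (Tmap u)
        (fun k h => pmor_fun f _ h = rmap _ x) fH cH incrT cvT.
    * by move=> k; exact: (@affine_fiber _ _ _ (pmor_fun f _)).
    * by move=> k; apply/dE; rewrite -(dnat x (uu k)) [d u x]xy hy.
    * move=> k h e; rewrite pmor_rmap e rmap_comp //; exact: ple_Tmap.
    rewrite -xy; apply/dE; exists h; apply/eqP; rewrite -subr_eq0; apply/eqP.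
    apply: (cG _ _ incrT cvT).1 => k.
    by rewrite rmapB -pmor_rmap hh subrr.
  + move=> ys hys.
    have [k|x hx] := (cH us u incr cv).2 (fun k => pmor_fun l _ (ys k)).
      by rewrite -pmor_rmap hys.
    have /lE[y0 hy0] : pmor_fun f u x = 0.
      apply: (cG us u incr cv).1 => k; rewrite -pmor_rmap hx.
      by apply/lE; exists (ys k).
    (* The restrictions of [y0] and the [ys] agree in H. Their differences come from a compatible
       family in G, whose limit [g] corrects [y0]. *)
    have [|||g hg] := @seq_limit_point _ _ _ _ G (fun k => Tmap (us k)) (Tmap u)
        (fun k g => d (us k) g = ys k - rmap (us k) y0) fG cG incrT cvT.
    * by move=> k; exact: (@affine_fiber _ _ _ (d (us k))).
    * move=> k; apply/lK; rewrite linearB pmor_rmap hy0 hx; exact: subrr.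
    * move=> k h /= e; apply: etrans (esym (dnat h (incr k))) _.
      by rewrite [d _ h]e rmapB hys (rmap_comp y0 (incr k) (uu _)).
    exists (d u g + y0) => k.
    by rewrite rmapD (dnat g (uu k)) hg subrK.
- have [w [h1 h2]] := ple_upper_bound wH wG; exists w => u uw y.
  have /lK[x <-] : pmor_fun l u y = 0.
    by apply: bH; apply: contra uw => h; exact: ple_trans h1.
  have -> : x = 0; last exact: (linear0 (d u)).
  apply: bG; apply: contra uw => h; apply: ple_trans (ple_Tmap_self u) _.
  exact: ple_trans h2.
Qed.

End FiveLemma.

Section Cocone.
Variables (R : realType) (a b : R) (F : fieldType) (H G : pmod a b F) (f : pmor H G).
Variables (BH : frame H) (BG : frame G).
Hypotheses (jH : inJ H) (jG : inJ G).
Implicit Types p q r u : pt a b.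

Let vH : vanishes_on_bd H. Proof. by case: jH => _ [[]]. Qed.
Let vG : vanishes_on_bd G. Proof. by case: jG => _ [[]]. Qed.

Local Notation L := (cocone f BH BG).

Lemma inJ_cocone : inJ L.
Proof.
have [l hl] := cocone_projection f BH BG vH.
have lK u (y : pm_obj L u) :
    pmor_fun l u y = 0 <-> exists x : pm_obj G (Tmap u), connecting f BH BG u x = y.
  by apply: (projection_kernel vH (p := Tmap u) y hl); rewrite ?px_Tmap ?py_Tmap.
have lE u := projection_exact vG (p := u) hl.
have eq1 u : px u = b - py (Tmap u) by rewrite py_Tmap; lra.
have eq2 u : py u = a - px (Tmap u) by rewrite px_Tmap; lra.
have dlin u : linear (connecting f BH BG u : pm_obj G (Tmap u) -> pm_obj L u).
  by move=> c x y; exact: connecting_linear.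
pose d u : {linear pm_obj G (Tmap u) -> pm_obj L u} := linear_map (dlin u).
have dnat u v (x : pm_obj G (Tmap v)) : ple u v -> rmap u (d v x) = d u (rmap _ x).
  by move=> uv; apply: connecting_rmap => //; exact: ple_Tmap.
have dE u (x : pm_obj G (Tmap u)) : d u x = 0 <-> exists h, pmor_fun f _ h = x.
  exact: connecting_exact.
apply: (inJ_five dnat lE lK dE jH jG); apply/cohomologicalE; split.
- exact: bifiltered_vanishes.
- by apply: bifiltered_horizontal; exact: cocone_cap.
- by apply: bifiltered_vertical; exact: cocone_cap.
Qed.

(** One cocone gives both: the projection L -> H has the kernel of [f] as image, and the connecting
    map, read as a map from G to the shift of L, has the image of [f] as kernel. *)
Lemma weak_kernel_cokernel_frames : exists (K N : pmod a b F) (k : pmor K H) (n : pmor G N),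
  [/\ inJ K, inJ N, forall u, exact_at (pmor_fun k u) (pmor_fun f u)
    & forall u, exact_at (pmor_fun f u) (pmor_fun n u)].
Proof.
have [l hl] := cocone_projection f BH BG vH.
have [||n hn] := @pmor_make _ _ _ _ G (pm_shift L) (fun u x => connecting f BH BG (Tinv u) x).
- by move=> u c x y; exact: connecting_linear.
- move=> u v x uv; rewrite rmap_shift //; apply/esym; apply: connecting_rmap => //.
exists L, (pm_shift L), l, n; split.
- exact: inJ_cocone.
- exact/inJ_shift/inJ_cocone.
- by move=> u; exact: projection_exact.
- by move=> u x; rewrite hn; exact: connecting_exact.
Qed.

End Cocone.

Lemma weak_kernel_cokernel (R : realType) (a b : R) (F : fieldType) (H G : pmod a b F)
    (f : pmor H G) : inJ H -> inJ G ->
  exists (K N : pmod a b F) (k : pmor K H) (n : pmor G N),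
  [/\ inJ K, inJ N, forall u, exact_at (pmor_fun k u) (pmor_fun f u)
    & forall u, exact_at (pmor_fun f u) (pmor_fun n u)].
Proof.
move=> jH jG; have [BH] := frame_exists jH; have [BG] := frame_exists jG.
exact: weak_kernel_cokernel_frames BH BG jH jG.
Qed.

(** * Presentable functors *)

Section DirectSum.
Variables (R : realType) (a b : R) (F : fieldType).
Implicit Types (G H X : pmod a b F) (u v : pt a b).

Lemma pair_map_linear (V W V' W' : lmodType F) (f : {linear V -> V'}) (g : {linear W -> W'}) :
  linear (fun x : V * W => (f x.1, g x.2)).
Proof. by move=> c x y; rewrite /= !linearP. Qed.

Definition dsum G H : pmod a b F.
Proof.
exists (fun u => (pm_obj G u * pm_obj H u)%type : lmodType F)
  (fun u v h => linear_map (pair_map_linear (pm_map G h) (pm_map H h))).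
- by move=> u h [x y]; rewrite linear_mapE /= !pm_id.
- move=> u v w huv hvw huw [x y]; rewrite !linear_mapE /=.
  by rewrite !(pm_comp _ _ huw).
Defined.

Lemma rmap_dsum G H u v (x : pm_obj (dsum G H) v) :
  rmap u x = (rmap u x.1, rmap u x.2) :> pm_obj (dsum G H) u.
Proof.
have [uv|nuv] := boolP (ple u v); first by rewrite !(rmapE uv).
by rewrite !rmap0out.
Qed.

Lemma inJ_dsum G H : inJ G -> inJ H -> inJ (dsum G H).
Proof.
move=> [fG [[vG eG] [cG [wG bG]]]] [fH [[vH eH] [cH [wH bH]]]].
have ex p q r : exact_at (@rmap _ a b F G p r) (@rmap _ a b F G q p) ->
    exact_at (@rmap _ a b F H p r) (@rmap _ a b F H q p) ->
    exact_at (@rmap _ a b F (dsum G H) p r) (@rmap _ a b F (dsum G H) q p).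
  move=> e1 e2 [y z]; rewrite rmap_dsum /=; split.
  - move=> [/e1[x1 <-] /e2[x2 <-]]; exists (x1, x2); exact: rmap_dsum.
  - move=> [x]; rewrite rmap_dsum => -[h1 h2]; congr pair.
    + by apply/e1; exists x.1.
    + by apply/e2; exists x.2.
split; [|split; [split|split]].
- move=> u; have eG' := fG u; have eH' := fH u.
  have lf : linear (fun x : pm_obj G u => (x, 0) : pm_obj G u * pm_obj H u).
    by move=> c x y; rewrite -[RHS]/(c *: x + y, c *: 0 + 0) scaler0 addr0.
  apply: (fin_dim_exact (f := linear_map lf)
    (g := snd : {linear (pm_obj G u * pm_obj H u)%type -> pm_obj H u})) => //.
  by move=> [x y] /= ->; exists x.
- by move=> u hu [x y]; rewrite (vG u hu x) (vH u hu y).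
- move=> u v w h1 h2 h3 h4 h5 k.
  have [e1 [e2 e3]] := eG u v w h1 h2 h3 h4 h5 k.
  have [e1' [e2' e3']] := eH u v w h1 h2 h3 h4 h5 k.
  by split; [exact: ex | split; exact: ex].
- move=> us u incr cv; have [g1 g2] := cG us u incr cv; have [h1 h2] := cH us u incr cv.
  split.
  + move=> [x y] hxy; congr pair.
    * by apply: g1 => k; have := hxy k; rewrite rmap_dsum => -[].
    * by apply: h1 => k; have := hxy k; rewrite rmap_dsum => -[].
  + move=> xs hxs.
    have [k|x hx] := g2 (fun k => (xs k).1); first by rewrite -[in RHS]hxs rmap_dsum.
    have [k|y hy] := h2 (fun k => (xs k).2); first by rewrite -[in RHS]hxs rmap_dsum.
    by exists (x, y) => k; rewrite rmap_dsum /= hx hy -surjective_pairing.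
- have [w [h1 h2]] := ple_upper_bound wG wH; exists w => u uw [x y].
  rewrite (bG u _ x) ?(bH u _ y) //; apply: contra uw => h.
    exact: ple_trans h2.
  exact: ple_trans h1.
Qed.

Lemma pmor_sum G H X (f : pmor G X) (g : pmor H X) : exists s : pmor (dsum G H) X,
  forall u x, pmor_fun s u x = pmor_fun f u x.1 + pmor_fun g u x.2.
Proof.
apply: pmor_make => [u c x y|u v x uv].
- by rewrite /= !linearP scalerDr addrACA.
- by rewrite rmap_dsum /= !pmor_rmap rmapD.
Qed.

Lemma pmor_fst G H : exists s : pmor (dsum G H) G, forall u x, pmor_fun s u x = x.1.
Proof.
by apply: (@pmor_make _ _ _ _ (dsum G H) G (fun u x => x.1)) => // u v x uv; rewrite rmap_dsum.
Qed.

Lemma pmor_zero G H : exists s : pmor G H, forall u x, pmor_fun s u x = 0.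
Proof.
apply: (@pmor_make _ _ _ _ G H (fun u x => 0)) => [u c x y|u v x uv].
  by rewrite scaler0 addr0.
by rewrite rmap0.
Qed.

Lemma pmor_id G : exists s : pmor G G, forall u x, pmor_fun s u x = x.
Proof. exact: (@pmor_make _ _ _ _ G G (fun u x => x)). Qed.

(** The weak kernel of the sum map from [dsum G H] to [X], projected to [G]; the sign of the second
    component is absorbed into y. *)
Lemma weak_pullback G H X (f : pmor G X) (g : pmor H X) : inJ G -> inJ H -> inJ X ->
  exists (E : pmod a b F) (e : pmor E G), inJ E /\ forall u x,
    (exists z, pmor_fun e u z = x) <-> exists y, pmor_fun f u x = pmor_fun g u y.
Proof.
move=> jG jH jX; have [s hs] := pmor_sum f g.
have [E [_ [k [_ [jE _ kE _]]]]] := weak_kernel_cokernel s (inJ_dsum jG jH) jX.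
have [p hp] := pmor_fst G H.
exists E, (pmor_comp p k); split=> // u x; split.
- move=> [z <-]; have /(kE u) : exists z', pmor_fun k u z' = pmor_fun k u z by exists z.
  rewrite hs => /eqP; rewrite addr_eq0 => /eqP e.
  by exists (- (pmor_fun k u z).2); rewrite linearN -e [pmor_fun (pmor_comp _ _) _ _]hp.
- move=> [y e].
  have /(kE u)[z hz] : pmor_fun s u (x, - y) = 0 by rewrite hs /= linearN e subrr.
  by exists z; rewrite /= hz hp.
Qed.

Lemma kernel_factor G H K X (f : pmor G H) (k : pmor K G) (e : pmor X G) :
  is_kernel f k -> (forall u x, pmor_fun f u (pmor_fun e u x) = 0) ->
  exists e' : pmor X K, forall u x, pmor_fun k u (pmor_fun e' u x) = pmor_fun e u x.
Proof.
move=> kf fe.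
have lift u x : {y | pmor_fun k u y = pmor_fun e u x} by apply: cid; apply/(kf u).2; rewrite fe.
have [g liftE] : {g : forall u, pm_obj X u -> pm_obj K u |
    forall u x, pmor_fun k u (g u x) = pmor_fun e u x}.
  by exists (fun u x => sval (lift u x)) => u x; exact: (proj2_sig (lift u x)).
have [||e' he'] := @pmor_make _ _ _ _ X K g.
- by move=> u c x y; apply: (kf u).1; rewrite linearP !liftE linearP.
- by move=> u v x uv; apply: (kf u).1; rewrite pmor_rmap !liftE pmor_rmap.
by exists e' => u x; rewrite he'.
Qed.

Lemma cokernel_factor G H C X (f : pmor G H) (c : pmor H C) (n : pmor H X) :
  is_cokernel f c -> (forall u x, pmor_fun n u (pmor_fun f u x) = 0) ->
  exists n' : pmor C X, forall u y, pmor_fun n' u (pmor_fun c u y) = pmor_fun n u y.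
Proof.
move=> cf nf.
have lift u z : {y | pmor_fun c u y = z} by apply: cid; apply: (cf u).1.
have [g liftE] : {g : forall u, pm_obj C u -> pm_obj H u |
    forall u z, pmor_fun c u (g u z) = z}.
  by exists (fun u z => sval (lift u z)) => u z; exact: (proj2_sig (lift u z)).
have key u y y' : pmor_fun c u y = pmor_fun c u y' -> pmor_fun n u y = pmor_fun n u y'.
  move=> /eqP; rewrite -subr_eq0 -linearB => /eqP/(cf u).2[x hx].
  by apply/eqP; rewrite -subr_eq0 -linearB -hx nf.
have [||n' hn'] := @pmor_make _ _ _ _ C X (fun u z => pmor_fun n u (g u z)).
- by move=> u k x y; rewrite -linearP; apply: key; rewrite linearP !liftE.
- by move=> u v x uv; rewrite -pmor_rmap; apply: key; rewrite pmor_rmap !liftE.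
by exists n' => u y; rewrite hn'; apply: key; rewrite liftE.
Qed.

End DirectSum.

Section Presentable.
Variables (R : realType) (a b : R) (F : fieldType).
Implicit Types (A B C G H K X Y : pmod a b F) (u v : pt a b).

Lemma inJ_vanishes G : inJ G -> vanishes_on_bd G. Proof. by case=> _ [[]]. Qed.

Lemma presJ_vanishes X : presJ X -> vanishes_on_bd X.
Proof.
move=> [H [G [f [g [_ [jG ex]]]]]] u bd x; have [y <-] := (ex u).1 x.
by rewrite (inJ_vanishes jG bd y) linear0.
Qed.

Lemma presJ_pfd X : presJ X -> pfd X.
Proof.
move=> [H [G [f [g [_ [[fG _] ex]]]]]] u; have [n [e he]] := fG u.
exists n, (fun i => pmor_fun g u (e i)) => x; have [y <-] := (ex u).1 x.
have [c ->] := he y; exists c.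
by rewrite linear_sum; apply: eq_bigr => i _; rewrite linearZ.
Qed.

Lemma inJ_presJ G : inJ G -> presJ G.
Proof.
move=> jG; have [z hz] := pmor_zero G G; have [i hi] := pmor_id G.
exists G, G, z, i; split=> //; split=> // u; split; first by move=> x; exists x.
move=> x; rewrite hi; split=> [->|[y <-]]; last exact: hz.
by exists 0; exact: linear0.
Qed.

Lemma inJ_lift G X Y (e : pmor X Y) (f : pmor G Y) : inJ G -> vanishes_on_bd X ->
  (forall u y, exists x, pmor_fun e u x = y) ->
  exists g : pmor G X, forall u x, pmor_fun e u (pmor_fun g u x) = pmor_fun f u x.
Proof.
move=> jG vX se; have [B] := frame_exists jG.
exact: (frame_projective B f (inJ_vanishes jG) vX se).
Qed.

Lemma inJ_extend X Y G (m : pmor X Y) (f : pmor X G) : inJ G -> presJ Y ->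
  (forall u, injective (pmor_fun m u)) ->
  exists g : pmor Y G, forall u x, pmor_fun g u (pmor_fun m u x) = pmor_fun f u x.
Proof.
move=> jG pY; have [B] := frame_exists jG.
exact: (frame_injective B f (inJ_vanishes jG) (presJ_pfd pY) (presJ_vanishes pY)).
Qed.

(** Projectivity lifts [f] to a map [ph] of the covers, and the relations of C in [GB] are the image
    of [ph] together with the relations [hB] of B. *)
Lemma presJ_cokernel A B C (f : pmor A B) (c : pmor B C) :
  presJ A -> presJ B -> is_cokernel f c -> presJ C.
Proof.
move=> [HA [GA [hA [gA [_ [jGA eA]]]]]] [HB [GB [hB [gB [jHB [jGB eB]]]]]] cf.
have [ph hph] := inJ_lift (pmor_comp f gA) jGA (inJ_vanishes jGB) (fun u => (eB u).1).
have [s hs] := pmor_sum ph hB.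
exists (dsum GA HB), GB, s, (pmor_comp c gB).
split; first exact: inJ_dsum.
split=> // u; split.
  by move=> z; have [y <-] := (cf u).1 z; have [x <-] := (eB u).1 y; exists x.
move=> y; rewrite [pmor_fun (pmor_comp _ _) _ _]/=; split.
- move=> /(cf u).2[x]; have [z <-] := (eA u).1 x => e.
  have /(eB u).2[w hw] : pmor_fun gB u (y - pmor_fun ph u z) = 0.
    by rewrite linearB hph [pmor_fun (pmor_comp _ _) _ _]/= e subrr.
  by exists (z, w); rewrite hs /= hw addrC subrK.
- move=> [[z w] <-]; apply/(cf u).2; exists (pmor_fun gA u z).
  rewrite hs /= linearD hph [pmor_fun (pmor_comp _ _) _ _]/=.
  have -> : pmor_fun gB u (pmor_fun hB u w) = 0 by apply/(eB u).2; exists w.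
  by rewrite addr0.
Qed.

(** An element of [GA] maps into the kernel when [ph] sends it to a relation of B, so the weak
    pullback E of [ph] and [hB] covers K. An element of E is a relation when its image in [GA] is a
    relation of A, and a second weak pullback covers these. *)
Lemma presJ_kernel A B K (f : pmor A B) (k : pmor K A) :
  presJ A -> presJ B -> is_kernel f k -> presJ K.
Proof.
move=> [HA [GA [hA [gA [jHA [jGA eA]]]]]] [HB [GB [hB [gB [jHB [jGB eB]]]]]] kf.
have [ph hph] := inJ_lift (pmor_comp f gA) jGA (inJ_vanishes jGB) (fun u => (eB u).1).
have fgE u x : pmor_fun gB u (pmor_fun ph u x) = pmor_fun f u (pmor_fun gA u x).
  exact: hph.
have [E [e [jE eE]]] := weak_pullback ph hB jGA jHB jGB.
have [E2 [e2 [jE2 eE2]]] := weak_pullback e hA jE jHA jGA.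
have [u x|e' he'] := kernel_factor (e := pmor_comp gA e) kf.
  rewrite /= -fgE; apply/(eB u).2.
  have [|y ->] := (eE u (pmor_fun e u x)).1; first by exists x.
  by exists y.
exists E2, E, e2, e'; split=> //; split=> // u; split.
- move=> z; have [x hx] := (eA u).1 (pmor_fun k u z).
  have [|t ht] := (eE u x).2.
    have /(eB u).2[y hy] : pmor_fun gB u (pmor_fun ph u x) = 0.
      by rewrite fgE hx; apply/(kf u).2; exists z.
    by exists y.
  by exists t; apply: (kf u).1; rewrite he' /= ht.
- move=> t; apply: iff_trans (iff_sym (eE2 u t)).
  have -> : (exists y, pmor_fun e u t = pmor_fun hA u y) <->
            pmor_fun gA u (pmor_fun e u t) = 0.
    by split=> [[y ->]|/(eA u).2[y hy]]; [apply/(eA u).2; exists y | exists y].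
  have <- : pmor_fun k u (pmor_fun e' u t) = pmor_fun gA u (pmor_fun e u t) by exact: he'.
  split=> [->|h]; first exact: linear0.
  by apply: (kf u).1; rewrite h linear0.
Qed.

(** The pointwise cokernel lies in pres(J), so it is an admissible test object, and its projection
    from Y is compared with 0. *)
Lemma epi_presJ_surjective X Y (e : pmor X Y) : presJ X -> presJ Y -> epi_presJ e ->
  forall u y, exists x, pmor_fun e u x = y.
Proof.
move=> pX pY ep u y; have [C [c hc]] := cokernel_exists e.
have [z hz] := pmor_zero Y C; apply/(hc u).2.
rewrite -[RHS](hz u y); apply: ep; first exact: presJ_cokernel hc.
by move=> v x; rewrite hz; apply/(hc v).2; exists x.
Qed.

Lemma surjective_epi_presJ X Y (e : pmor X Y) :
  (forall u y, exists x, pmor_fun e u x = y) -> epi_presJ e.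
Proof. by move=> se Z g1 g2 _ h u y; have [x <-] := se u y; exact: h. Qed.

Lemma mono_presJ_injective X Y (m : pmor X Y) : presJ X -> presJ Y -> mono_presJ m ->
  forall u, injective (pmor_fun m u).
Proof.
move=> pX pY mo u x y e; have [K [k hk]] := kernel_exists m.
have [z hz] := pmor_zero K X.
have /(hk u).2[t ht] : pmor_fun m u (x - y) = 0 by rewrite linearB e subrr.
apply/eqP; rewrite -subr_eq0 -ht; apply/eqP; rewrite -[RHS](hz u t).
apply: mo; first exact: presJ_kernel hk.
by move=> v s; rewrite hz linear0; apply/(hk v).2; exists s.
Qed.

Lemma injective_mono_presJ X Y (m : pmor X Y) :
  (forall u, injective (pmor_fun m u)) -> mono_presJ m.
Proof. by move=> im Z g1 g2 _ h u z; apply: (im u). Qed.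

Lemma inJ_projective G : inJ G -> projective_presJ G.
Proof.
move=> jG; split; first exact: inJ_presJ.
move=> X Y e f pX pY ep; apply: inJ_lift => //; first exact: presJ_vanishes.
exact: epi_presJ_surjective.
Qed.

Lemma inJ_injective G : inJ G -> injective_presJ G.
Proof.
move=> jG; split; first exact: inJ_presJ.
by move=> X Y m f pX pY mo; apply: inJ_extend => //; exact: mono_presJ_injective.
Qed.

Lemma presJ_cover X : presJ X -> exists (G : pmod a b F) (e : pmor G X),
  inJ G /\ forall u x, exists y, pmor_fun e u y = x.
Proof. by move=> [H [G [f [g [_ [jG ex]]]]]]; exists G, g; split=> // u; case: (ex u). Qed.

(** The weak cokernel G -> N of a presentation H -> G has exactly the image of H as kernel, so it
    descends to an injection of X. *)
Lemma presJ_embedding X : presJ X -> exists (N : pmod a b F) (m : pmor X N),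
  inJ N /\ forall u, injective (pmor_fun m u).
Proof.
move=> [H [G [f [g [jH [jG ex]]]]]].
have [_ [N [_ [n [_ jN _ nE]]]]] := weak_kernel_cokernel f jH jG.
have [u x|m hm] := cokernel_factor (n := n) ex; first by apply/(nE u); exists x.
exists N, m; split=> // u x x' /eqP; rewrite -subr_eq0 -linearB => /eqP.
have [y hy] := (ex u).1 (x - x'); rewrite -hy hm => /(nE u)/(ex u).2.
by rewrite hy => /eqP; rewrite subr_eq0 => /eqP.
Qed.

Lemma projective_inJ X : projective_presJ X -> inJ X.
Proof.
move=> [pX lX]; have [G [e [jG se]]] := presJ_cover pX; have [i hi] := pmor_id X.
have [s hs] := lX G X e i (inJ_presJ jG) pX (surjective_epi_presJ se).
by apply: (retract_inJ (i := s) (r := e)) => // u x; rewrite hs hi.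
Qed.

Lemma injective_inJ X : injective_presJ X -> inJ X.
Proof.
move=> [pX lX]; have [N [m [jN im]]] := presJ_embedding pX; have [i hi] := pmor_id X.
have [r hr] := lX X N m i pX (inJ_presJ jN) (injective_mono_presJ im).
by apply: (retract_inJ (i := m) (r := r)) => // u x; rewrite hr hi.
Qed.

End Presentable.

Theorem theorem1p1 (R : realType) (a b : R) (F : fieldType) (hab : a < b) :
  (* closed under kernels computed in Vect^{M°} *)
  (forall (A B K : pmod a b F) (f : pmor A B) (k : pmor K A),
      presJ A -> presJ B -> is_kernel f k -> presJ K) /\
  (* closed under cokernels computed in Vect^{M°} *)
  (forall (A B C : pmod a b F) (f : pmor A B) (c : pmor B C),
      presJ A -> presJ B -> is_cokernel f c -> presJ C) /\
  (* enough projectives *)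
  (forall X : pmod a b F, presJ X ->
      exists (P : pmod a b F) (e : pmor P X), projective_presJ P /\ epi_presJ e) /\
  (* enough injectives *)
  (forall X : pmod a b F, presJ X ->
      exists (I : pmod a b F) (m : pmor X I), injective_presJ I /\ mono_presJ m) /\
  (* projectives = injectives *)
  (forall X : pmod a b F, presJ X -> (projective_presJ X <-> injective_presJ X)) /\
  (* projective(-injective) objects are exactly those in J *)
  (forall X : pmod a b F, presJ X -> (projective_presJ X <-> inJ X)).
Proof.
split; first by move=> A B K f k; exact: presJ_kernel.
split; first by move=> A B C f c; exact: presJ_cokernel.
split.
  move=> X /presJ_cover[P [e [jP se]]]; exists P, e.
  by split; [exact: inJ_projective | exact: surjective_epi_presJ].
split.
  move=> X /presJ_embedding[I [m [jI im]]]; exists I, m.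
  by split; [exact: inJ_injective | exact: injective_mono_presJ].
split=> X _; split.
- by move/projective_inJ; exact: inJ_injective.
- by move/injective_inJ; exact: inJ_projective.
- exact: projective_inJ.
- exact: inJ_projective.
Qed.
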